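(* Let $\Omega$ be a domain of the complex plane, let $H$ be a complex Hilbert space and $T\in\mathcal{B}(H)$ with $\sigma(T)\subset\overline{\Omega}$, and let $K\ge1$ and $\rho\ge1$ be real numbers. Set $$\widetilde{K} =\frac{K^2+1+\sqrt{(K^2+1)^2-4\rho (2-\rho )K^2}}{2\rho K}.$$ Then $\Omega$ is a $K$-spectral set for $T$ if and only if $\Omega$ is a $\widetilde{K}$-$w_\rho$ set for $T$. Also, $\Omega$ is a complete $K$-spectral set for $T$ if and only if $\Omega$ is a complete $\widetilde{K}$-$w_\rho$ set for $T$.
   Context: $\mathcal{B}(H)$ denotes the bounded linear operators on the complex Hilbert space $H$; a domain is a connected open set. Operator radii: for $\rho\ge1$, an operator $S\in\mathcal{B}(H)$ is in the class $\mathcal{C}_\rho$ if there exist a Hilbert space $\mathcal{H}\supset H$ and a unitary operator $U\in\mathcal{B}(\mathcal{H})$ with $S^n=\rho\,PU^nP^*$ for all $n=1,2,\dots$, where $P:\mathcal{H}\to H$ is the orthogonal projection onto $H$ (so $P^*$ is the inclusion). The operator $\rho$-radius is $w_\rho(A)=\inf\{\lambda>0:\lambda^{-1}A\in\mathcal{C}_\rho\}$; in particular $w_1(A)=\|A\|$, and $w_2$ is the numerical radius. Spectral sets: since $\sigma(T)\subset\overline{\Omega}$, $f(T)$ is defined for every rational function $f$ with poles off $\overline{\Omega}$. Put $\|f\|_\Omega=\sup_{z\in\Omega}|f(z)|$. For $c\ge1$, $\Omega$ is a $c$-spectral set for $T$ if $\|f(T)\|\le c\|f\|_\Omega$ for every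 rational function $f$ with poles off $\overline{\Omega}$, and a $c$-$w_\rho$ set for $T$ if $w_\rho(f(T))\le c\|f\|_\Omega$ for every such $f$. The complete versions require the same inequalities for all $n\ge1$ and all $n\times n$ matrices $F=(f_{ij})$ of rational functions with poles off $\overline{\Omega}$, where $F(T)=(f_{ij}(T))$ acts on $H^{(n)}$ (the $\ell_2$-sum of $n$ copies of $H$) and $\|F\|_\Omega=\sup_{z\in\Omega}\|F(z)\|$ with the operator norm on $n\times n$ matrices. *)

(* Defs.v *)
From HB Require Import structures.
From mathcomp Require Import all_boot all_order all_algebra.
From mathcomp Require Import all_classical all_reals all_analysis.
From mathcomp Require Import complex.

Set Implicit Arguments.
Unset Strict Implicit.
Unset Printing Implicit Defensive.

Import Order.TTheory GRing.Theory Num.Theory.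
Import numFieldNormedType.Exports.

Local Open Scope classical_set_scope.
Local Open Scope ring_scope.
Local Open Scope complex_scope.

(* A complex Hilbert space is a complete normed space over R[i] whose norm is
   induced by an inner product (linear on the left, antilinear on the right). *)
HB.mixin Record isHilbert (R : realType) H & CompleteNormedModule R[i] H := {
  inner : {dot H for (@Num.conj R[i])} ;
  inner_norm : forall x : H, (inner : H -> H -> R[i]) x x = `|x| ^+ 2
}.

#[short(type="hilbertType")]
HB.structure Definition Hilbert (R : realType) :=
  {H of CompleteNormedModule R[i] H & isHilbert R H}.

Lemma dot_CauchySchwarz (C : numClosedFieldType) (U : lmodType C)
    (f : {dot U for (@Num.conj C)}) (u v : U) :
  `|f u v| <= sqrtC (f u u) * sqrtC (f v v).
Proof.
have [->|v0] := eqVneq v 0.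
  by rewrite !linear0r normr0 sqrtC0 mulr0.
have fv0 : 0 < f v v by rewrite neq0_dnorm_gt0.
rewrite -ler_sqr ?nnegrE ?mulr_ge0 ?sqrtC_ge0 ?dnorm_ge0//.
rewrite exprMn !sqrtCK.
pose a := f u v / f v v.
have := dnorm_ge0 f (u - a *: v).
have fuv : f (u - a *: v) v = 0.
  by rewrite linearBl/= linearZl_LR/= divfK ?subrr// gt_eqF.
rewrite linearBr/= linearZr_LR/= fuv mulr0 subr0 linearBl/= linearZl_LR/=.
rewrite subr_ge0 /a mulrAC ler_pdivrMr//.
by rewrite [f v u](hermC f) expr0 mul1r -normCK.
Qed.

Lemma dot_triangle (C : numClosedFieldType) (U : lmodType C)
    (f : {dot U for (@Num.conj C)}) (u v : U) :
  sqrtC (f (u + v) (u + v)) <= sqrtC (f u u) + sqrtC (f v v).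
Proof.
rewrite -ler_sqr ?nnegrE ?addr_ge0 ?sqrtC_ge0 ?dnorm_ge0//.
rewrite sqrrD !sqrtCK (dnormD f u v)/= addrAC lerD2r lerD2l.
have reD (d : C) : d + d^* <= `|d| *+ 2.
  rewrite -[d + d^*](@divfK _ 2) ?pnatr_eq0// -ReE -[leRHS]mulr_natr.
  by rewrite ler_pM2r ?ltr0n// leif_Re_Creal.
by rewrite (le_trans (reD _))// lerMn2r/= dot_CauchySchwarz.
Qed.

Definition l2sum (R : realType) (n : nat) (H : hilbertType R) : Type :=
  {ffun 'I_n -> H}.

HB.instance Definition _ (R : realType) (n : nat) (H : hilbertType R) :=
  GRing.Lmodule.copy (l2sum n H) {ffun 'I_n -> H}.

Definition l2sum_inner (R : realType) (n : nat) (H : hilbertType R)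
  (x y : l2sum n H) : R[i] := \sum_(i < n) inner (x i) (y i).

Section l2sum_hilbert.
Variables (R : realType) (n : nat) (H : hilbertType R).
Implicit Types x y z : l2sum n H.
Local Notation "''[' x , y ]" := (l2sum_inner x y).

Let innerl y : GRing.linear_for *%R (@l2sum_inner R n H ^~ y).
Proof.
move=> a x z; rewrite /l2sum_inner mulr_sumr -big_split; apply: eq_bigr => i _.
by rewrite !ffunE linearPl.
Qed.

Let innerr x : GRing.linear_for (@Num.conj R[i] \; *%R) (@l2sum_inner R n H x).
Proof.
move=> a y z; rewrite /l2sum_inner/= mulr_sumr -big_split; apply: eq_bigr => i _.
by rewrite !ffunE linearPr.
Qed.

HB.instance Definition _ := bilinear_isBilinear.Build R[i] (l2sum n H)
  (l2sum n H) R[i] *%R (@Num.conj R[i] \; *%R) (@l2sum_inner R n H)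
  (innerl, innerr).

Let innerC x y : '[x, y] = (-1) ^+ false * Num.conj '[y, x].
Proof.
rewrite expr0 mul1r rmorph_sum; apply: eq_bigr => i _.
by rewrite [LHS](hermC inner) expr0 mul1r.
Qed.

HB.instance Definition _ := isHermitianSesquilinear.Build R[i] (l2sum n H)
  false (@Num.conj R[i]) (@l2sum_inner R n H) innerC.

Let inner_gt0 x : x != 0 -> 0 < '[x, x].
Proof.
move=> x0; rewrite lt_neqAle sumr_ge0 ?andbT => [|i _]; last exact: dnorm_ge0.
apply: contra x0 => /eqP/esym x0; apply/eqP/ffunP => i; apply/eqP.
rewrite ffunE -(dnorm_eq0 inner); apply/eqP.
by move/psumr_eq0P : x0 => -> // j _; exact: dnorm_ge0.
Qed.

HB.instance Definition _ := isDotProduct.Build R[i] (l2sum n H)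
  (@l2sum_inner R n H) inner_gt0.

Let sqnorm x : R[i] := sqrtC '[x, x].

Let sqnormD x y : sqnorm (x + y) <= sqnorm x + sqnorm y.
Proof. exact: (dot_triangle (@l2sum_inner R n H)). Qed.

Let sqnormZ (a : R[i]) x : sqnorm (a *: x) = `|a| * sqnorm x.
Proof.
rewrite /sqnorm (dnormZ (@l2sum_inner R n H)) sqrtCM ?nnegrE ?exprn_ge0//.
by rewrite sqrCK.
Qed.

Let sqnorm_eq0 x : sqnorm x = 0 -> x = 0.
Proof. by move/eqP; rewrite sqrtC_eq0 (dnorm_eq0 (@l2sum_inner R n H)) => /eqP. Qed.

HB.instance Definition _ :=
  Lmodule_isNormed.Build R[i] (l2sum n H) sqnormD sqnormZ sqnorm_eq0.

Let l2sum_norm x : '[x, x] = `|x| ^+ 2.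
Proof. by rewrite [`|x|]/(sqnorm x) sqrtCK. Qed.

Let norm_coord_le x i : `|x i| <= `|x|.
Proof.
rewrite -ler_sqr ?nnegrE// -l2sum_norm -inner_norm /l2sum_inner (bigD1 i)//=.
by rewrite lerDl sumr_ge0// => j _; exact: dnorm_ge0.
Qed.

Let norm_le_sum x : `|x| <= \sum_i `|x i|.
Proof.
rewrite -ler_sqr ?nnegrE ?sumr_ge0// -l2sum_norm /l2sum_inner.
under eq_bigr do rewrite inner_norm.
rewrite expr2 mulr_sumr ler_sum// => i _.
by rewrite expr2 ler_wpM2r// (bigD1 i)//= lerDl sumr_ge0.
Qed.

Let l2sum_complete (F : set_system (l2sum n H)) :
  ProperFilter F -> cauchy F -> cvg F.
Proof.
move=> FF /cauchy_ballP Fc.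
have Fci i : cauchy ((fun x : l2sum n H => x i) @ F).
  apply/cauchy_ballP => e e0; rewrite near_map2.
  apply: filterS (Fc e e0) => -[x y]/=; rewrite -!ball_normE/= => xy.
  by apply: le_lt_trans xy; have := norm_coord_le (x - y) i; rewrite !ffunE.
have Fcvg i : (fun x : l2sum n H => x i) @ F -->
    lim ((fun x : l2sum n H => x i) @ F) by exact: cauchy_cvg.
apply/cvg_ex; exists [ffun i => lim ((fun x : l2sum n H => x i) @ F)].
set l := (X in _ --> X).
apply/fcvgrPdist_lt => e e0.
have d0 : 0 < e / n.+1%:R by rewrite divr_gt0.
have : \forall x \near F, forall i, `|l i - (x : l2sum n H) i| < e / n.+1%:R.
  apply: filter_forall => i; have /cvgrPdist_lt/(_ _ d0) := Fcvg i.
  by rewrite /l ffunE.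
apply: filterS => x lx; apply: le_lt_trans (norm_le_sum _) _.
apply: (@le_lt_trans _ _ (\sum_(i < n) e / n.+1%:R)).
  by apply: ler_sum => i _; have := lx i; rewrite !ffunE => /ltW.
rewrite sumr_const card_ord -[ltLHS]mulr_natr -mulrA gtr_pMr//.
by rewrite mulrC ltr_pdivrMr// mul1r ltr_nat.
Qed.

HB.instance Definition _ :=
  Uniform_isComplete.Build (l2sum n H) l2sum_complete.

HB.instance Definition _ := isHilbert.Build R (l2sum n H) l2sum_norm.
End l2sum_hilbert.

Definition bounded_op (R : realType) (H K : hilbertType R) (A : H -> K) : Prop :=
  linear A /\ continuous A.

Definition is_adjoint (R : realType) (H K : hilbertType R)
    (A : H -> K) (B : K -> H) : Prop :=
  forall x y, inner (A x) y = inner x (B y).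

Definition unitary (R : realType) (H : hilbertType R) (U : H -> H) : Prop :=
  bounded_op U /\
  exists V : H -> H,
    [/\ bounded_op V, is_adjoint U V, cancel U V & cancel V U].

(* An inclusion of Hilbert spaces H \subset K is represented by a linear map J
   that preserves the inner product; P is then the orthogonal projection
   K -> H onto the copy J(H) of H. *)
Definition hilbert_inclusion (R : realType) (H K : hilbertType R)
    (J : H -> K) : Prop :=
  linear J /\ forall x y, inner (J x) (J y) = inner x y.

Definition orthogonal_projection (R : realType) (H K : hilbertType R)
    (J : H -> K) (P : K -> H) : Prop :=
  forall u y, inner (u - J (P u)) (J y) = 0.

Definition class_C (R : realType) (rho : R) (H : hilbertType R)
    (S : H -> H) : Prop :=
  bounded_op S /\
  exists (K : hilbertType R) (J : H -> K) (P : K -> H) (U : K -> K),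
    [/\ hilbert_inclusion J, orthogonal_projection J P, unitary U &
      forall n, (0 < n)%N ->
        forall x, iter n S x = rho%:C *: P (iter n U (J x))].

Definition op_radius (R : realType) (rho : R) (H : hilbertType R)
    (A : H -> H) : \bar R :=
  ereal_inf [set l%:E | l in [set l : R |
    0 < l /\ class_C rho (fun x => (l^-1)%:C *: A x)]].

(* Norms of normedModType R[i] live in R[i]; they are real, so taking the real
   part loses nothing. *)
Definition op_norm (R : realType) (H : hilbertType R) (A : H -> H) : \bar R :=
  ereal_sup [set (complex.Re `|A x|)%:E | x in [set x : H | `|x| <= 1]].

Definition op_invertible (R : realType) (H : hilbertType R)
    (A : H -> H) : Prop :=
  exists B : H -> H, [/\ bounded_op B, cancel A B & cancel B A].

Definition spectrum (R : realType) (H : hilbertType R) (T : H -> H) :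
    set R[i]^o :=
  [set l | ~ op_invertible (fun x => T x - (l : R[i]) *: x)].

(* A rational function with poles off S is a quotient of two polynomials whose
   denominator does not vanish on S; [ratden_neq0] only matters for empty S. *)
Record ratfun (R : realType) (S : set R[i]^o) := RatFun {
  ratnum : {poly R[i]} ;
  ratden : {poly R[i]} ;
  ratden_neq0 : ratden != 0 ;
  ratden_off : forall z : R[i], S z -> ratden.[z] != 0
}.

Definition rat_eval (R : realType) (S : set R[i]^o) (f : ratfun S)
    (z : R[i]) : R[i] :=
  (ratnum f).[z] / (ratden f).[z].

Definition poly_op (R : realType) (H : hilbertType R) (p : {poly R[i]})
    (T : H -> H) (x : H) : H :=
  \sum_(k < size p) p`_k *: iter k T x.

(* [op_inv A] is the inverse of A when A is bijective.  When the spectrum of T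
   is contained in S, q(T) is bijective for every polynomial q without zeros
   in S, so that [rat_op f T] is p(T) q(T)^-1 for f = p / q. *)
Definition op_inv (R : realType) (H : hilbertType R) (A : H -> H) (y : H) : H :=
  get [set x : H | A x = y].

Definition rat_op (R : realType) (S : set R[i]^o) (H : hilbertType R)
    (f : ratfun S) (T : H -> H) : H -> H :=
  poly_op (ratnum f) T \o op_inv (poly_op (ratden f) T).

Definition ratmx_op (R : realType) (S : set R[i]^o) (H : hilbertType R)
    (n : nat) (F : 'M[ratfun S]_n) (T : H -> H) (x : l2sum n H) : l2sum n H :=
  [ffun i => \sum_j rat_op (F i j) T (x j)].

Definition l2norm (R : realType) (n : nat) (v : 'cV[R[i]]_n) : R :=
  Num.sqrt (\sum_i (complex.Re `|v i 0|) ^+ 2).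

Definition mx_norm2 (R : realType) (n : nat) (A : 'M[R[i]]_n) : \bar R :=
  ereal_sup [set (l2norm (A *m v))%:E | v in [set v | l2norm v <= 1]].

Definition rat_norm (R : realType) (Omega S : set R[i]^o) (f : ratfun S) :
    \bar R :=
  ereal_sup [set (complex.Re `|rat_eval f z|)%:E | z in Omega].

Definition ratmx_norm (R : realType) (Omega S : set R[i]^o) (n : nat)
    (F : 'M[ratfun S]_n) : \bar R :=
  ereal_sup [set mx_norm2 (map_mx (fun f => rat_eval f z) F) | z in Omega].

Definition spectral_set (R : realType) (H : hilbertType R) (c : R)
    (Omega : set R[i]^o) (T : H -> H) : Prop :=
  forall f : ratfun (closure Omega),
    (op_norm (rat_op f T) <= c%:E * rat_norm Omega f)%E.

Definition radius_set (R : realType) (H : hilbertType R) (c rho : R)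
    (Omega : set R[i]^o) (T : H -> H) : Prop :=
  forall f : ratfun (closure Omega),
    (op_radius rho (rat_op f T) <= c%:E * rat_norm Omega f)%E.

Definition complete_spectral_set (R : realType) (H : hilbertType R) (c : R)
    (Omega : set R[i]^o) (T : H -> H) : Prop :=
  forall n, (0 < n)%N -> forall F : 'M[ratfun (closure Omega)]_n,
    (op_norm (ratmx_op F T) <= c%:E * ratmx_norm Omega F)%E.

Definition complete_radius_set (R : realType) (H : hilbertType R) (c rho : R)
    (Omega : set R[i]^o) (T : H -> H) : Prop :=
  forall n, (0 < n)%N -> forall F : 'M[ratfun (closure Omega)]_n,
    (op_radius rho (ratmx_op F T) <= c%:E * ratmx_norm Omega F)%E.

Definition Ktilde (R : realType) (K rho : R) : R :=
  (K ^+ 2 + 1 +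
   Num.sqrt ((K ^+ 2 + 1) ^+ 2 - 4 * rho * (2 - rho) * K ^+ 2)) /
  (2 * rho * K).

(* Main.v *)
From HB Require Import structures.
Require Import Defs.
From mathcomp Require Import all_boot all_order all_algebra.
From mathcomp Require Import all_classical all_reals all_analysis.
From mathcomp Require Import complex ring lra zify separable cyclotomic cyclic.
Set Implicit Arguments.
Unset Strict Implicit.
Unset Printing Implicit Defensive.
Import Order.TTheory GRing.Theory Num.Theory.
Import numFieldNormedType.Exports.
Local Open Scope classical_set_scope.
Local Open Scope ring_scope.
Local Open Scope complex_scope.

Local Notation Re := complex.Re.
Local Notation Im := complex.Im.

(** Let B be the set of all F(T) with ||F|| <= 1, and write
    a = (k + r) / (1 + k r) for the larger root of
    rho k a^2 - (k^2 + 1) a + (2 - rho) k, so that a decreases to K~ as k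
    decreases to K.  For S in B, the operator S / a is of class C_rho when
      rho |x|^2 - 2 (rho - 1) Re <z S x, x> / a + (rho - 2) |S x|^2 / a^2
    is nonnegative for all x and all z on the unit circle (up to a margin), and
    this expression is a positive multiple of
      k^2 |x - r z S x|^2 - |S x - r z^* x|^2.
    Thus it says that the Moebius transforms of S with parameter of modulus r
    have norm at most k.  As B is stable under the Moebius maps of the disc, the
    bounds w_rho <= K~ and ||.|| <= K on B are equivalent.

    The quadratic condition yields a rho-dilation by an explicit model: on
    l2(Z; H) the bilateral shift is unitary for the form
      rho B(g, h) = (rho - 2) <Dg, Dh> + <g, Dh> + <Dg, h>,
      (Dg)_n = g_n - S g_(n-1),
    which is equivalent to the l2 form by the quadratic condition (read in
    Fourier variables), and x |-> (S^n x)_(n >= 0) embeds H isometrically. *)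

(** * Real parts of inner products *)

(** The classical criterion for class C_rho is that the real part of 1 + (2 / rho) sum_(n >= 1) z^n
    S^n be nonnegative on the open disc. Evaluated at h = x - z S x, rho times this kernel is (rho -
    2) |h|^2 + 2 Re <x, h>: the inverse of 1 - z S has disappeared, and expanding gives the
    quadratic expression of the overview. The form B is the same formula with the shift in place of
    z. Passing from a positive kernel to a dilation usually takes a quotient and a completion. The
    margin avoids both, since it makes the form definite and equivalent to the l2 form, which is
    already complete. The margin is available because the radius is an infimum: it is enough to
    treat each mu > K~, to which some k > K corresponds, and k^2 - K^2 is the room gained. In the
    same way, a radius at most K~ yields class C_rho for some l < mu, which moves z into the open
    disc. Averages over roots of unity and finite geometric sums take the place of integrals over
    the circle and of operator-valued series. *)

Section ComplexModulus.
Variable R : realType.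
Implicit Types (z w : R[i]) (a : R).

Definition csq z : R := Re z ^+ 2 + Im z ^+ 2.

Lemma csq_ge0 z : 0 <= csq z.
Proof. by rewrite addr_ge0 ?sqr_ge0. Qed.

Lemma csqM z w : csq (z * w) = csq z * csq w.
Proof. by case: z w => [a b] [c d]; rewrite /csq /=; ring. Qed.

Lemma csqR a : csq a%:C = a ^+ 2.
Proof. by rewrite /csq /= expr0n addr0. Qed.

Lemma csq1 : csq 1 = 1.
Proof. by rewrite (csqR 1) expr1n. Qed.

Lemma csqX z n : csq (z ^+ n) = csq z ^+ n.
Proof. by elim: n => [|n IH]; rewrite ?csq1// !exprS csqM IH. Qed.

Lemma csq_conj z : csq (Num.conj z) = csq z.
Proof. by case: z => a b; rewrite /csq /= sqrrN. Qed.

Lemma csq_normE z : (csq z)%:C = `|z| ^+ 2.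
Proof. exact: add_Re2_Im2. Qed.

Lemma csq_Re_norm z : csq z = Re `|z| ^+ 2.
Proof. by apply: complexI; rewrite csq_normE -(RRe_real (normr_real z)) -rmorphXn. Qed.

Lemma csq_eq0 z : (csq z == 0) = (z == 0).
Proof.
rewrite -(inj_eq (@complexI R)) csq_normE rmorph0 expf_eq0 /=.
by rewrite normr_eq0.
Qed.

Lemma cRe_conj z : Re (Num.conj z) = Re z.
Proof. by case: z. Qed.

Lemma cIm_conj z : Im (Num.conj z) = - Im z.
Proof. by case: z. Qed.

Lemma cReM z w : Re (z * w) = Re z * Re w - Im z * Im w.
Proof. by case: z w => [a b] [c d]. Qed.

Lemma cImM z w : Im (z * w) = Re z * Im w + Im z * Re w.
Proof. by case: z w => [a b] [c d]. Qed.

Lemma cReD z w : Re (z + w) = Re z + Re w.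
Proof. by case: z w => [a b] [c d]. Qed.

Lemma cImD z w : Im (z + w) = Im z + Im w.
Proof. by case: z w => [a b] [c d]. Qed.

Lemma cReZ a z : Re (a%:C * z) = a * Re z.
Proof. by case: z => [b c] /=; rewrite mul0r subr0. Qed.

Lemma mulCi_sqr : 'i * 'i = -1 :> R[i].
Proof. by rewrite -expr2 sqr_i. Qed.

Lemma complex_split z : z = (Re z)%:C + (Im z)%:C * 'i.
Proof. by case: z => a b; apply/eqP; rewrite eq_complex /=; apply/andP; split; apply/eqP; ring. Qed.

End ComplexModulus.

(** The real part of a positive semidefinite Hermitian form; invariance under i is what remains of
    sesquilinearity. Values in [R] let [lra] and [nra] do the estimates, and one record covers
    Hilbert spaces, column vectors, l2 sequences and the form of the dilation. *)
Record real_form (R : realType) (V : lmodType R[i]) (b : V -> V -> R) : Prop :=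
  RealForm {
  rfDl : forall x y z, b (x + y) z = b x z + b y z ;
  rfZl : forall (a : R) x y, b (a%:C *: x) y = a * b x y ;
  rfC : forall x y, b x y = b y x ;
  rfI : forall x y, b ('i *: x) ('i *: y) = b x y ;
  rf_ge0 : forall x, 0 <= b x x }.

Section RealForm.
Variables (R : realType) (V : lmodType R[i]) (b : V -> V -> R).
Hypothesis bP : real_form b.
Implicit Types (x y z : V) (a : R) (c : R[i]).

Lemma rfDr x y z : b x (y + z) = b x y + b x z.
Proof. by rewrite !(rfC bP x) rfDl. Qed.

Lemma rfZr a x y : b x (a%:C *: y) = a * b x y.
Proof. by rewrite !(rfC bP x) rfZl. Qed.

Lemma rfNl x y : b (- x) y = - b x y.
Proof.
have -> : - x = (-1 : R)%:C *: x by rewrite rmorphN1 scaleN1r.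
by rewrite rfZl// mulN1r.
Qed.

Lemma rfNr x y : b x (- y) = - b x y.
Proof. by rewrite !(rfC bP x) rfNl. Qed.

Lemma rfBl x y z : b (x - y) z = b x z - b y z.
Proof. by rewrite rfDl// rfNl. Qed.

Lemma rfBr x y z : b x (y - z) = b x y - b x z.
Proof. by rewrite rfDr// rfNr. Qed.

Lemma rf0l y : b 0 y = 0.
Proof. by rewrite -(subrr y) rfBl subrr. Qed.

Lemma rf0r y : b y 0 = 0.
Proof. by rewrite rfC// rf0l. Qed.

Lemma rfIN x y : b ('i *: x) y = - b x ('i *: y).
Proof.
rewrite -[LHS](rfI bP) scalerA mulCi_sqr scaleN1r.
by rewrite rfNl.
Qed.

Lemma rf_suml (I : Type) (s : seq I) (P : pred I) (F : I -> V) y :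
  b (\sum_(i <- s | P i) F i) y = \sum_(i <- s | P i) b (F i) y.
Proof. by apply: (big_morph (b ^~ y)) => [u v|]; rewrite ?rfDl ?rf0l. Qed.

Lemma rf_sumr (I : Type) (s : seq I) (P : pred I) (F : I -> V) y :
  b y (\sum_(i <- s | P i) F i) = \sum_(i <- s | P i) b y (F i).
Proof. by apply: (big_morph (b y)) => [u v|]; rewrite ?rfDr ?rf0r. Qed.

Lemma rf_scalel c x y :
  b (c *: x) y = Re c * b x y - Im c * b x ('i *: y).
Proof.
rewrite {1}(complex_split c) scalerDl -scalerA rfDl// !rfZl// rfIN.
by rewrite mulrN.
Qed.

Lemma rf_scaler c x y :
  b x (c *: y) = Re c * b x y + Im c * b x ('i *: y).
Proof. by rewrite {1}(complex_split c) scalerDl -scalerA rfDr !rfZr. Qed.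

Lemma rf_conj c x y : b (c *: x) y = b x (Num.conj c *: y).
Proof. by rewrite rf_scalel [RHS]rf_scaler cRe_conj cIm_conj mulNr. Qed.

Lemma rf_xix x : b x ('i *: x) = 0.
Proof.
have := rfIN x x; rewrite (rfC bP ('i *: x)) => /eqP.
by rewrite -addr_eq0 -mulr2n mulrn_eq0 => /eqP.
Qed.

Lemma rf_scale2 c x y : b (c *: x) (c *: y) = csq c * b x y.
Proof.
rewrite rf_conj scalerA [X in b x X](_ : _ = (csq c)%:C *: y) ?rfZr//.
congr (_ *: _); case: (c) => u v; apply/eqP; rewrite eq_complex /csq /=.
by apply/andP; split; apply/eqP; ring.
Qed.

Lemma rf_sqD x y : b (x + y) (x + y) = b x x + 2 * b x y + b y y.
Proof. by rewrite rfDl// !rfDr (rfC bP y x); ring. Qed.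

Lemma rf_sqB x y : b (x - y) (x - y) = b x x - 2 * b x y + b y y.
Proof. by rewrite rf_sqD !rfNr rfNl; ring. Qed.

Lemma rf_CS x y : b x y ^+ 2 <= b x x * b y y.
Proof.
have H a d : 0 <= a ^+ 2 * b x x + 2 * (a * d) * b x y + d ^+ 2 * b y y.
  have := rf_ge0 bP (a%:C *: x + d%:C *: y).
  by rewrite rf_sqD !(rfZl bP, rfZr) => h; apply: le_trans h _; lra.
have := H (b y y) (- b x y).
have [h|] := ltrP 0 (b y y).
  rewrite -subr_ge0 => h1.
  rewrite -subr_ge0 -(pmulr_rge0 _ h) (le_trans h1)// le_eqVlt; apply/orP; left.
  by apply/eqP; ring.
move=> h _; have y0 : b y y = 0 by apply/eqP; rewrite eq_le h rf_ge0.
(* When b y y = 0 these coefficients turn the quadratic into -(b x y)^2 (b x x + 2), which forces b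
   x y = 0. *)
have := H (- b x y) (b x x + 1); rewrite y0 => h2.
have := rf_ge0 bP x.
nra.
Qed.

Lemma rf_abs x y : `|b x y| <= Num.sqrt (b x x) * Num.sqrt (b y y).
Proof. by rewrite -sqrtrM ?rf_ge0// -sqrtr_sqr ler_wsqrtr// rf_CS. Qed.

Lemma rf_amgm x y : 2 * `|b x y| <= b x x + b y y.
Proof.
have := rf_ge0 bP (x + y); have := rf_ge0 bP (x - y).
rewrite rf_sqB rf_sqD => h1 h2.
by case: (ger0P (b x y)) => _; lra.
Qed.

Lemma rf_sqD_le x y : b (x + y) (x + y) <= 2 * b x x + 2 * b y y.
Proof. by have := rf_ge0 bP (x - y); rewrite rf_sqB rf_sqD; lra. Qed.

Lemma rf_sqB_le x y : b (x - y) (x - y) <= 2 * b x x + 2 * b y y.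
Proof. by have := rf_ge0 bP (x + y); rewrite rf_sqB rf_sqD; lra. Qed.

End RealForm.

Section Rdot.
Variables (R : realType) (H : hilbertType R).
Implicit Types (x y z : H).

Definition rdot x y : R := Re (inner x y).
Local Notation nsq x := (rdot x x).

Lemma inner_conj x y : inner x y = Num.conj (inner y x).
Proof. by rewrite [LHS](hermC inner) expr0 mul1r. Qed.

Lemma rdot_form : real_form rdot.
Proof.
split; rewrite /rdot.
- by move=> x y z; rewrite linearDl cReD.
- by move=> a x y; rewrite linearZl_LR /= cReZ.
- by move=> x y; rewrite inner_conj cRe_conj.
- move=> x y; rewrite linearZl_LR linearZr_LR /= mulrA.
  rewrite (_ : 'i * _ = 1) ?mul1r//.
  by apply/eqP; rewrite eq_complex /=; apply/andP; split; apply/eqP; ring.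
- by move=> x; have := dnorm_ge0 inner x; rewrite lecE => /andP[].
Qed.

Lemma nsq_norm x : nsq x = Re `|x| ^+ 2.
Proof.
by rewrite /rdot inner_norm -(RRe_real (normr_real x)) -rmorphXn.
Qed.

Lemma norm_nsq x : `|x| = (Num.sqrt (nsq x))%:C.
Proof.
rewrite nsq_norm sqrtr_sqr ger0_norm ?RRe_real ?normr_real//.
by have := normr_ge0 x; rewrite lecE => /andP[].
Qed.

Lemma nsq_eq0 x : (nsq x == 0) = (x == 0).
Proof.
rewrite -(dnorm_eq0 inner) /= inner_norm norm_nsq -rmorphXn /= sqr_sqrtr ?(rf_ge0 rdot_form)//.
by rewrite -[0 in RHS]/((0 : R)%:C) (inj_eq (@complexI R)).
Qed.

Lemma innerE x y : inner x y = (rdot x y +i* rdot x ('i *: y))%C.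
Proof.
rewrite /rdot linearZr_LR /=; case: (inner x y) => a b /=.
by apply/eqP; rewrite eq_complex /=; apply/andP; split; apply/eqP; ring.
Qed.

Lemma rdot_inj x y : (forall z, rdot x z = rdot y z) -> x = y.
Proof.
move=> h; apply/eqP; rewrite -subr_eq0 -nsq_eq0.
by rewrite {1}(rfBl rdot_form) h subrr.
Qed.

Lemma norm_lt_nsq x (e : R) : 0 < e -> (`|x| < e%:C) = (nsq x < e ^+ 2).
Proof.
move=> e0; rewrite norm_nsq ltcR -[X in Num.sqrt _ < X](ger0_norm (ltW e0)) -sqrtr_sqr.
by rewrite ltr_sqrt// exprn_gt0.
Qed.

Lemma norm_le_nsq x (e : R) : 0 <= e -> (`|x| <= e%:C) = (nsq x <= e ^+ 2).
Proof.
move=> e0; rewrite norm_nsq lecR -[X in Num.sqrt _ <= X](ger0_norm e0) -sqrtr_sqr.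
by rewrite ler_sqrt// exprn_ge0.
Qed.

End Rdot.
Notation nsq x := (rdot x x).

(** This is (rho - 2) |h|^2 + 2 Re <x, h> for h = x - u, expanded; it is used at u = z S x. *)
Definition qform (R : realType) (H : hilbertType R) (rho : R) (u x : H) : R :=
  rho * nsq x - 2 * (rho - 1) * rdot u x + (rho - 2) * nsq u.

(** * The Riesz representation; operators with a dilation *)

Lemma real_eps0 (R : realType) (a c : R) :
  (forall e : R, 0 < e -> a <= c * e) -> a <= 0.
Proof.
move=> h; rewrite leNgt; apply/negP => a0.
have [c0|c0] := lerP c 0.
  by have := h 1 ltr01; rewrite mulr1; lra.
have := h (a / (2 * c)); rewrite divr_gt0 ?mulr_gt0// => /(_ isT).
rewrite (_ : c * _ = a / 2); first lra.
by field; rewrite gt_eqF.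
Qed.

Section HilbertComplete.
Variables (R : realType) (H : hilbertType R).

Lemma hilbert_complete (F : set_system H) : ProperFilter F ->
  (forall e : R, 0 < e ->
     exists2 A, F A & forall x y, A x -> A y -> nsq (x - y) < e) ->
  exists l : H, forall e : R, 0 < e -> F [set x | nsq (l - x) < e].
Proof.
move=> FF cF.
have /cauchy_cvg/cvg_ex[l Fl] : cauchy F.
  apply/cauchy_ballP => e e0.
  have [r r0 re] : exists2 r : R, 0 < r & e = r%:C.
    by case: e e0 => a b; rewrite ltcE /= => /andP[/eqP -> a0]; exists a.
  have [A FA hA] := cF (r ^+ 2) (exprn_gt0 _ r0).
  exists (A, A) => //= -[x y] /= [Ax Ay].
  by rewrite -ball_normE /= re norm_lt_nsq//; exact: hA.
exists l => e e0; move/fcvgrPdist_lt : Fl.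
have se0 : 0 < Num.sqrt e by rewrite sqrtr_gt0.
have sC : 0 < (Num.sqrt e)%:C by rewrite ltcR.
move=> /(_ _ sC); apply: filterS => x /=.
by rewrite norm_lt_nsq// sqr_sqrtr// ltW.
Qed.

(** The representing vector minimizes q x = |x|^2 - 2 phi x. Near-minimizers form a Cauchy filter by
    the parallelogram law, and the first variation at the limit is the required identity. *)
Lemma riesz (phi : H -> R) (M : R) :
  (forall x y, phi (x + y) = phi x + phi y) ->
  (forall (a : R) x, phi (a%:C *: x) = a * phi x) ->
  (forall x, phi x ^+ 2 <= M * nsq x) ->
  exists w, forall x, phi x = rdot w x.
Proof.
move=> phiD phiZ phiM.
have rP := rdot_form H.
pose q x := nsq x - 2 * phi x.
(* The bound on phi gives the sign of M only when H has a nonzero vector, whence [|M|] below. *)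
have M0 (x : H) : x != 0 -> 0 <= M.
  move=> x0; have n0 : 0 < nsq x by rewrite lt_neqAle eq_sym nsq_eq0 x0 (rf_ge0 rP).
  by rewrite -(pmulr_lge0 _ n0) (le_trans _ (phiM x))// sqr_ge0.
have phi0 : phi 0 = 0 by rewrite -(scale0r 0) -(rmorph0 (real_complex R)) phiZ mul0r.
have q_ge x : - `|M| <= q x.
  have [->|x0] := eqVneq x 0.
    by rewrite /q phi0 (rf0l rP) mulr0 subr0 oppr_le0.
  have := phiM x; rewrite (ger0_norm (M0 _ x0)) /q.
  have := rf_ge0 rP x; have := M0 _ x0; move: (phi x) (nsq x) => p n m0 n0 pmn.
  suff : 2 * p <= M + n by lra.
  apply: le_trans (ler_norm _) _; rewrite -ler_sqr ?nnegrE ?addr_ge0//.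
  rewrite -normrX ger0_norm ?sqr_ge0//; have := sqr_ge0 (M - n); nra.
have qI : has_inf (range q).
  split; first by exists (q 0), 0.
  by exists (- `|M|) => _ [x _ <-].
pose m := inf (range q).
have qm x : m <= q x by apply: ge_inf; [case: qI | exists x].
pose A (e : R) := [set x | q x < m + e].
have A0 (e : R) : 0 < e -> exists x, A e x.
  move=> e0; have [_ [x _ <-] xe] := inf_adherent e0 qI.
  by exists x.
pose F := filter_from [set e : R | 0 < e] A.
have FF : ProperFilter F.
  apply: filter_from_proper; last by move=> e e0; exact: A0.
  apply: filter_from_filter; first by exists 1; exact: ltr01.
  move=> e d /= e0 d0; exists (Num.min e d); first by rewrite lt_min e0.
  move=> x; rewrite /A /= => h; split; apply: lt_le_trans h _;
    by rewrite lerD2l ge_min lexx ?orbT.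
have [l lP] : exists l : H, forall e : R, 0 < e -> F [set x | nsq (l - x) < e].
  apply: hilbert_complete => e e0; exists (A (e / 4)).
    by exists (e / 4) => //=; rewrite divr_gt0//.
  move=> x y; rewrite /A /=.
  (* |x - y|^2 = 2 q x + 2 q y - 4 q ((x + y) / 2), and q is at least m at the midpoint. *)
  have := qm ((2^-1)%:C *: (x + y)); rewrite /q phiZ phiD (rfZl rP) (rfZr rP).
  rewrite (rf_sqD rP) (rf_sqB rP); lra.
exists l => y; apply/eqP; rewrite -subr_eq0 -sqrf_eq0 eq_le sqr_ge0 andbT.
apply: (@real_eps0 _ _ (4 * nsq y)) => e e0.
have [x [/= xq xl]] : exists x, (A e `&` [set x | nsq (l - x) < e]) x.
  by apply: (@filter_ex _ F); apply: filterI; [exists e | exact: lP].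
have n0 := rf_ge0 rP y.
have dP : (rdot x y - phi y) ^+ 2 <= e * nsq y.
  have [y0|y0] := eqVneq y 0.
    by rewrite y0 phi0 !(rf0r rP) subrr expr0n mulr0.
  have ny : 0 < nsq y by rewrite lt_neqAle eq_sym nsq_eq0 y0 n0.
  (* The best step from x along y lowers q by (<x, y> - phi y)^2 / |y|^2, and q x is within e of the
     infimum. *)
  have := qm (x + (- ((rdot x y - phi y) / nsq y))%:C *: y).
  rewrite /q phiD phiZ (rf_sqD rP) (rfZl rP) !(rfZr rP).
  move: xq; rewrite /A /= /q.
  set d := _ - phi y; set t : R := d / nsq y; move=> xq h.
  have tn : t * (t * nsq y) = t * d by rewrite divfK// gt_eqF.
  have td : t * d = t * rdot x y - t * phi y by rewrite mulrBr.
  have : d * t < e by rewrite mulrC; move: h; lra.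
  rewrite mulrA -expr2.
  by rewrite ltr_pdivrMr// => /ltW.
have lP2 : rdot (l - x) y ^+ 2 <= e * nsq y.
  by apply: le_trans (rf_CS rP _ _) _; rewrite ler_wpM2r// ltW.
have -> : phi y - rdot l y = - (rdot (l - x) y + (rdot x y - phi y)).
  by rewrite (rfBl rP); ring.
rewrite sqrrN; move: (rdot (l - x) y) (rdot x y - phi y) lP2 dP => u v hu hv.
have -> : (u + v) ^+ 2 = 2 * u ^+ 2 + 2 * v ^+ 2 - (u - v) ^+ 2 by ring.
have := sqr_ge0 (u - v); lra.
Qed.

End HilbertComplete.

Section LinearFun.
Variables (R : pzRingType) (V W : lmodType R) (f : V -> W).
Hypothesis f_lin : linear f.

Lemma lin0 : f 0 = 0.
Proof.
have := f_lin 1 0 0; rewrite !scale1r addr0 => /eqP.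
by rewrite -[X in X == _]addr0 (inj_eq (addrI _)) eq_sym => /eqP.
Qed.

Lemma linZ a x : f (a *: x) = a *: f x.
Proof. by rewrite -[_ *: x]addr0 f_lin lin0 addr0. Qed.

Lemma linD x y : f (x + y) = f x + f y.
Proof. by rewrite -[x]scale1r f_lin !scale1r. Qed.

Lemma linN x : f (- x) = - f x.
Proof. by rewrite -scaleN1r linZ scaleN1r. Qed.

Lemma linB x y : f (x - y) = f x - f y.
Proof. by rewrite linD linN. Qed.

Lemma lin_sum (I : Type) (s : seq I) (P : pred I) (F : I -> V) :
  f (\sum_(i <- s | P i) F i) = \sum_(i <- s | P i) f (F i).
Proof. by apply: (big_morph f) => [u v|]; rewrite ?linD ?lin0. Qed.

End LinearFun.

Lemma lin_iter (R : pzRingType) (V : lmodType R) (f : V -> V) n :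
  linear f -> linear (iter n f).
Proof. by move=> fl; elim: n => [//|n IH] a x y /=; rewrite IH fl. Qed.

Lemma geometric_le0 (R : realType) (a c t : R) : 0 <= t -> t < 1 ->
  (forall n, a <= c * t ^+ n.+1) -> a <= 0.
Proof.
move=> t0 t1 h.
rewrite -(mulr0 c).
have tl : (fun n => c * t ^+ n) @ \oo --> c * 0.
  by apply: cvgMr; apply: cvg_expr; rewrite ger0_norm.
rewrite -(cvg_lim _ tl)//; apply: limr_ge; first by apply/cvg_ex; exists (c * 0).
by exists 1%N => // -[//|n] _.
Qed.

Lemma iter_unitary_form (R : realType) (H : hilbertType R) (U : H -> H) n x y :
  unitary U -> rdot (iter n U x) (iter n U y) = rdot x y.
Proof.
move=> [_ [V [_ UV UK _]]]; elim: n => //= n IH.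
by rewrite {1}/rdot UV UK.
Qed.

Section ClassCForm.
Variables (R : realType) (H : hilbertType R).

(** Let h = x - z S x and let y be the solution of y - z U y = J h. As U is isometric and |z| < 1, 2
    Re <y, J h> - |h|^2 = |y|^2 - |z U y|^2 is nonnegative. By the dilation, and since the sum of
    the z^n S^n h telescopes, Re <y, J h> = |h|^2 + Re <z S x, h> / rho; the two together are the
    claim divided by rho. The proof uses partial sums of the Neumann series for y and lets the
    errors decay. *)
Lemma class_C_qform (rho : R) (S : H -> H) (z : R[i]) (x : H) :
  1 <= rho -> class_C rho S -> csq z < 1 -> 0 <= qform rho (z *: S x) x.
Proof.
move=> rho1 [[Slin _] [K [J [P [U [[Jlin Jiso] JP Uu dil]]]]]] z1.
have rP := rdot_form H; have kP := rdot_form K.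
have rho0 : 0 < rho by exact: lt_le_trans ltr01 rho1.
have Jr a b : rdot (J a) (J b) = rdot a b by rewrite /rdot Jiso.
have PJ u y : rdot u (J y) = rdot (P u) y.
  have := congr1 (@complex.Re R) (JP u y); rewrite -/(rdot _ _) (rfBl kP) Jr => /eqP.
  by rewrite subr_eq0 => /eqP.
pose h := x - z *: S x.
pose u n := z ^+ n *: iter n U (J h).
have dilr n a b : (0 < n)%N ->
    rdot (z ^+ n *: iter n U (J a)) (J b) = rho^-1 * rdot (z ^+ n *: iter n S a) b.
  move=> n0; rewrite PJ.
  (* P is given only by its orthogonality relation, from which homogeneity is deduced. *)
  have Zl c v : P (c *: v) = c *: P v.
    by apply: rdot_inj => w; rewrite -PJ (rf_conj kP) (rf_conj rP) -PJ (linZ Jlin).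
  rewrite Zl dil// (_ : _ *: (_ *: _) = rho%:C *: (z ^+ n *: P (iter n U (J a)))); last first.
    by rewrite !scalerA mulrC.
  by rewrite (rfZl rP) mulKf// gt_eqF.
have [[Ulin _] _] := Uu.
pose y N := \sum_(n < N) u n.
pose v N := z ^+ N *: iter N S x.
set s := csq z in z1; pose t := Num.sqrt s.
have s0 : 0 <= s by exact: csq_ge0.
have t0 : 0 <= t by exact: sqrtr_ge0.
have t1 : t < 1 by rewrite -sqrtr1 ltr_sqrt.
have tN N : Num.sqrt (s ^+ N) = t ^+ N by elim: N => [|N IH]; rewrite ?sqrtr1// !exprS sqrtrM// IH.
have zU N : z *: U (u N) = u N.+1 by rewrite /u (linZ Ulin) scalerA -exprS.
have yU N : y N - z *: U (y N) = J h - u N.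
  elim: N => [|N IH].
    by rewrite /y big_ord0 (lin0 Ulin) scaler0 subr0 /u expr0 scale1r /= subrr.
  rewrite /y big_ord_recr /= -/(y N) (linD Ulin) scalerDr zU opprD addrACA IH.
  by rewrite addrA subrK.
have hv n : z ^+ n *: iter n S h = v n - v n.+1.
  rewrite /h (linB (lin_iter n Slin)) scalerBr; congr (_ - _).
  by rewrite (linZ (lin_iter n Slin)) scalerA -exprSr -iterSr.
have yJ N : rdot (y N.+1) (J h) = nsq h + rho^-1 * rdot (v 1%N - v N.+1) h.
  elim: N => [|N IH].
    by rewrite /y big_ord_recr big_ord0 /= add0r /u expr0 scale1r /= Jr subrr (rf0l rP) mulr0 addr0.
  rewrite /y big_ord_recr /= -/(y N.+1) (rfDl kP) IH dilr// hv -addrA -mulrDr -(rfDl rP).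
  by rewrite addrA subrK.
have uh N : nsq (u N) = s ^+ N * nsq h.
  by rewrite (rf_scale2 kP) csqX iter_unitary_form// Jr.
have uw N a b : `|rdot (z ^+ N *: iter N U (J a)) (J b)| <=
    t ^+ N * (Num.sqrt (nsq a) * Num.sqrt (nsq b)).
  apply: le_trans (rf_abs kP _ _) _.
  rewrite (rf_scale2 kP) csqX iter_unitary_form// !Jr sqrtrM ?exprn_ge0//.
  by rewrite tN mulrA.
have hh : Num.sqrt (nsq h) * Num.sqrt (nsq h) = nsq h.
  by rewrite -expr2 sqr_sqrtr// (rf_ge0 rP).
(* The powers of S are controlled through the unitary U, so the remainder decays like |z|^(N+1)
   without a norm bound on S. *)
have vN N : - (rho^-1 * rdot (v N.+1) h) <= t ^+ N.+1 * (Num.sqrt (nsq x) * Num.sqrt (nsq h)).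
  rewrite -dilr//; apply: le_trans (uw N.+1 x h).
  by rewrite -normrN ler_norm.
have d0 : 0 < 1 - s by rewrite subr_gt0.
suff A0 : - (nsq h + 2 * (rho^-1 * rdot (v 1%N) h)) <= 0.
  rewrite -(pmulr_rge0 _ (_ : 0 < rho^-1)) ?invr_gt0//.
  rewrite oppr_le0 in A0; apply: le_trans A0 _.
  rewrite le_eqVlt; apply/orP; left; apply/eqP.
  rewrite /h /v expr1 /= /qform (rf_sqB rP) (rfC rP x) (rfBr rP).
  by field; rewrite gt_eqF.
set C1 : R := Num.sqrt (nsq x) * Num.sqrt (nsq h) in vN.
apply: (@geometric_le0 _ _ (2 * C1 + 2 * nsq h + nsq h / (1 - s)) t) => // N.
have h0 := rf_ge0 rP h.
(* Substituting z U y = y - (J h - u) here gives 2 <y, J h> - |h|^2 = (1 - s) |y|^2 up to terms that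
   contain u. *)
have e1 : nsq (z *: U (y N.+1)) = s * nsq (y N.+1).
  by rewrite (rf_scale2 kP) (iter_unitary_form 1).
have e2 : z *: U (y N.+1) = y N.+1 - (J h - u N.+1) by rewrite -yU subKr.
move: e1; rewrite e2 (rf_sqB kP) (rfBr kP) yJ (rf_sqB kP (J h)) Jr uh (rfBl rP (v 1%N)).
have := vN N; have := uw N.+1 h h; rewrite -/(u N.+1) hh (rfC kP (u _)) => w1 w2.
have w3 : s ^+ N.+1 * nsq h <= t ^+ N.+1 * nsq h.
  rewrite ler_wpM2r// -tN -[X in X <= _]sqr_sqrtr ?exprn_ge0// tN.
  by rewrite expr2 ler_piMr ?exprn_ge0// exprn_ile1// ltW.
(* No bound on |y| is at hand; weighting the square by 1 - s lets the slack (1 - s) |y|^2 absorb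
   this cross term. *)
have w4 : - (2 * rdot (y N.+1) (u N.+1)) <= (1 - s) * nsq (y N.+1) + nsq (u N.+1) / (1 - s).
  have := rf_ge0 kP ((1 - s)%:C *: y N.+1 + u N.+1).
  rewrite (rf_sqD kP) !(rfZl kP) (rfZr kP) => k0.
  rewrite -subr_ge0 -(pmulr_rge0 _ d0).
  rewrite [X in 0 <= X](_ : _ = (1 - s) * ((1 - s) * nsq (y N.+1)) +
    2 * ((1 - s) * rdot (y N.+1) (u N.+1)) + nsq (u N.+1))//.
  by field; rewrite gt_eqF.
have w5 : s ^+ N.+1 * nsq h / (1 - s) <= t ^+ N.+1 * nsq h / (1 - s).
  by rewrite ler_wpM2r// invr_ge0 ltW.
have w6 : rdot (J h) (u N.+1) <= t ^+ N.+1 * nsq h by apply: le_trans (ler_norm _) w1.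
rewrite uh in w4.
move=> e3.
have w7 : 0 <= s ^+ N.+1 * nsq h by rewrite mulr_ge0 ?exprn_ge0.
lra.
Qed.

End ClassCForm.

(** * Hilbert spaces from real forms *)

Record hilbert_form (R : realType) (V : lmodType R[i]) (b : V -> V -> R) : Prop :=
  HilbertForm {
  hf_form : real_form b ;
  hf_eq0 : forall x, b x x = 0 -> x = 0 ;
  hf_complete : forall F : set_system V, ProperFilter F ->
    (forall e : R, 0 < e ->
       exists2 A, F A & forall x y, A x -> A y -> b (x - y) (x - y) < e) ->
    exists l : V, forall e : R, 0 < e -> F [set x | b (l - x) (l - x) < e] }.

(** A copy of V tagged with the form, so that the norm and the topology are attached to b and
    different forms on one V do not clash. *)
Definition form_space (R : realType) (V : lmodType R[i]) (b : V -> V -> R)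
  (bP : hilbert_form b) : Type := V.

HB.instance Definition _ (R : realType) (V : lmodType R[i]) (b : V -> V -> R)
    (bP : hilbert_form b) :=
  GRing.Lmodule.copy (form_space bP) V.

Section FormSpace.
Variables (R : realType) (V : lmodType R[i]) (b : V -> V -> R).
Variable bP : hilbert_form b.
Local Notation K := (form_space bP).
Let fP := hf_form bP.

(* The complex inner product is recovered from its real part by
   <x, y> = Re <x, y> + i Re <x, i y>. *)
Definition form_inner (x y : K) : R[i] := b x y +i* b x ('i *: (y : V)).

Lemma form_innerDl x y z : form_inner (x + y) z = form_inner x z + form_inner y z.
Proof. by rewrite /form_inner !(rfDl fP). Qed.

Lemma form_innerC x y : form_inner x y = Num.conj (form_inner y x).
Proof.
rewrite /form_inner; apply/eqP; rewrite eq_complex /= (rfC fP x) eqxx /=.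
by rewrite (rfC fP) (rfIN fP).
Qed.

Lemma form_innerZl c x y : form_inner (c *: x) y = c * form_inner x y.
Proof.
rewrite /form_inner !(rf_scalel fP) scalerA mulCi_sqr scaleN1r (rfNr fP).
by case: c => u v; apply/eqP; rewrite eq_complex /=; apply/andP; split; apply/eqP; ring.
Qed.

Lemma form_innerDr x y z : form_inner x (y + z) = form_inner x y + form_inner x z.
Proof. by rewrite form_innerC form_innerDl rmorphD (form_innerC x y) (form_innerC x z). Qed.

Lemma form_innerZr c x y : form_inner x (c *: y) = Num.conj c * form_inner x y.
Proof. by rewrite form_innerC form_innerZl rmorphM (form_innerC x y). Qed.

Let innerl y : GRing.linear_for *%R (form_inner ^~ y).
Proof. by move=> a x z; rewrite form_innerDl form_innerZl. Qed.

Let innerr x : GRing.linear_for (@Num.conj R[i] \; *%R) (form_inner x).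
Proof. by move=> a y z; rewrite form_innerDr form_innerZr. Qed.

HB.instance Definition _ := bilinear_isBilinear.Build R[i] K K R[i] *%R
  (@Num.conj R[i] \; *%R) form_inner (innerl, innerr).

Let innerC x y : form_inner x y = (-1) ^+ false * Num.conj (form_inner y x).
Proof. by rewrite expr0 mul1r -form_innerC. Qed.

HB.instance Definition _ := isHermitianSesquilinear.Build R[i] K
  false (@Num.conj R[i]) form_inner innerC.

Lemma form_inner_diag x : form_inner x x = (b x x)%:C.
Proof. by rewrite /form_inner (rf_xix fP). Qed.

Let inner_gt0 x : x != 0 -> 0 < form_inner x x.
Proof.
move=> x0; rewrite form_inner_diag ltcR lt_neqAle (rf_ge0 fP) andbT eq_sym.
by apply: contra x0 => /eqP/(hf_eq0 bP) ->.
Qed.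

HB.instance Definition _ := isDotProduct.Build R[i] K form_inner inner_gt0.

Let fnorm (x : K) : R[i] := sqrtC (form_inner x x).

Let fnormD x y : fnorm (x + y) <= fnorm x + fnorm y.
Proof. exact: (dot_triangle form_inner). Qed.

Let fnormZ (a : R[i]) x : fnorm (a *: x) = `|a| * fnorm x.
Proof.
rewrite /fnorm (dnormZ form_inner) sqrtCM ?nnegrE ?exprn_ge0//.
by rewrite sqrCK.
Qed.

Let fnorm_eq0 x : fnorm x = 0 -> x = 0.
Proof. by move/eqP; rewrite sqrtC_eq0 (dnorm_eq0 form_inner) => /eqP. Qed.

HB.instance Definition _ :=
  Lmodule_isNormed.Build R[i] K fnormD fnormZ fnorm_eq0.

Let inner_norm x : form_inner x x = `|x| ^+ 2.
Proof. by rewrite [`|x|]/(fnorm x) sqrtCK. Qed.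

Let form_norm_lt (x : K) (e : R) : 0 < e -> (`|x| < e%:C) = (b x x < e ^+ 2).
Proof.
move=> e0; rewrite -[in LHS](@ltr_sqr R[i]) ?nnegrE ?normr_ge0 ?ler0c ?ltW//.
by rewrite -inner_norm form_inner_diag -rmorphXn ltcR.
Qed.

Let form_complete (F : set_system K) : ProperFilter F -> cauchy F -> cvg F.
Proof.
move=> FF /cauchy_ballP Fc.
have [e e0|l lP] := hf_complete bP FF.
  have se0 : 0 < Num.sqrt e by rewrite sqrtr_gt0.
  have sC : 0 < (Num.sqrt e)%:C by rewrite ltcR.
  have [[A B] /= [FA FB] AB] := Fc _ sC.
  exists (A `&` B); first exact: filterI.
  move=> x y [Ax _] [_ By]; have := AB (x, y) (conj Ax By).
  by rewrite /= -ball_normE /= form_norm_lt// sqr_sqrtr// ltW.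
apply/cvg_ex; exists l; apply/fcvgrPdist_lt => e e0.
have [r r0 ->] : exists2 r : R, 0 < r & e = r%:C.
  by case: e e0 => u v; rewrite ltcE /= => /andP[/eqP -> a0]; exists u.
by apply: filterS (lP (r ^+ 2) (exprn_gt0 _ r0)) => x; rewrite /= form_norm_lt.
Qed.

HB.instance Definition _ := Uniform_isComplete.Build K form_complete.

HB.instance Definition _ := isHilbert.Build R K inner_norm.

End FormSpace.

(** * Summation over the integers *)

Section IntSums.
Variable R : realType.
Implicit Types (c d : int -> R) (N : nat).

(** As [Negz k] is -(k + 1), the partial sum [zsum c N] runs over the window -N <= n < N. Moving the
    window by one exchanges two boundary terms only, which gives the shift invariance of [rsum]. *)
Definition zterm c : R ^nat := fun k => c (Posz k) + c (Negz k).
Definition zsum c N : R := \sum_(k < N) zterm c k.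
Definition absummable c := exists C, forall N, zsum (fun n => `|c n|) N <= C.
Definition rsum c : R := limn (zsum c).

Lemma zsumS c N : zsum c N.+1 = zsum c N + (c (Posz N) + c (Negz N)).
Proof. by rewrite /zsum big_ord_recr. Qed.

Lemma zsum0 c : zsum c 0 = 0.
Proof. by rewrite /zsum big_ord0. Qed.

Lemma zsumD c d N : zsum (fun n => c n + d n) N = zsum c N + zsum d N.
Proof. by elim: N => [|N IH]; rewrite ?zsum0 ?addr0// !zsumS IH; ring. Qed.

Lemma zsumZ (a : R) c N : zsum (fun n => a * c n) N = a * zsum c N.
Proof. by elim: N => [|N IH]; rewrite ?zsum0 ?mulr0// !zsumS IH; ring. Qed.

Lemma ler_zsum c d N : (forall n, c n <= d n) -> zsum c N <= zsum d N.
Proof. by move=> cd; apply: ler_sum => k _; apply: lerD. Qed.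

Lemma zsum_ge0 c N : (forall n, 0 <= c n) -> 0 <= zsum c N.
Proof. by move=> c0; apply: sumr_ge0 => k _; apply: addr_ge0. Qed.

Lemma zsum_nondecr c : (forall n, 0 <= c n) -> nondecreasing_seq (zsum c).
Proof.
move=> c0; apply/nondecreasing_seqP => N.
by rewrite zsumS lerDl addr_ge0.
Qed.

Lemma zsum_series c : zsum c = series (zterm c).
Proof. by apply/funext => N; rewrite /series /= big_mkord. Qed.


Lemma absummableP c (M : R) :
  (forall n, 0 <= c n) -> (forall N, zsum c N <= M) -> absummable c.
Proof.
move=> c0 cM; exists M => N; apply: le_trans (cM N); apply: ler_zsum => n.
by rewrite ger0_norm.
Qed.

Lemma absummable_le c d : (forall n, `|d n| <= `|c n|) -> absummable c -> absummable d.
Proof. by move=> dc [M cM]; exists M => N; apply: le_trans (cM N); exact: ler_zsum. Qed.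

Lemma absummableD c d :
  absummable c -> absummable d -> absummable (fun n => c n + d n).
Proof.
move=> [M cM] [M' dM]; exists (M + M') => N; apply: le_trans (lerD (cM N) (dM N)).
by rewrite -zsumD; apply: ler_zsum => n; exact: ler_normD.
Qed.

Lemma absummableZ (a : R) c : absummable c -> absummable (fun n => a * c n).
Proof.
move=> [M cM]; exists (`|a| * M) => N.
apply: (@le_trans _ _ (zsum (fun n => `|a| * `|c n|) N)).
  by apply: ler_zsum => n; rewrite normrM.
by rewrite zsumZ ler_wpM2l.
Qed.

Lemma rsum_cvg c : absummable c -> zsum c @ \oo --> rsum c.
Proof.
move=> [M cM]; rewrite /rsum zsum_series.
suff : cvgn (series (zterm c)) by [].
apply: normed_cvg; apply: nondecreasing_is_cvgn.
  by apply/nondecreasing_seqP => N; rewrite /normed_series_of /series /= !big_mkord big_ord_recr lerDl.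
exists M => _ [N _ <-]; apply: le_trans (cM N).
rewrite /normed_series_of /series /= big_mkord; apply: ler_sum => k _.
exact: ler_normD.
Qed.

Lemma rsum_lim c (l : R) : zsum c @ \oo --> l -> rsum c = l.
Proof. by move=> h; apply: cvg_lim. Qed.

Lemma rsumD c d : absummable c -> absummable d ->
  rsum (fun n => c n + d n) = rsum c + rsum d.
Proof.
move=> cs ds; apply: rsum_lim.
rewrite (_ : zsum _ = zsum c \+ zsum d); last by apply/funext => N; exact: zsumD.
by apply: cvgD; exact: rsum_cvg.
Qed.

Lemma rsumZ (a : R) c : absummable c -> rsum (fun n => a * c n) = a * rsum c.
Proof.
move=> cs; apply: rsum_lim.
rewrite (_ : zsum _ = (fun N => a * zsum c N)); last by apply/funext => N; exact: zsumZ.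
by apply: cvgMr; exact: rsum_cvg.
Qed.

Lemma zsum_le_rsum c N : (forall n, 0 <= c n) -> absummable c -> zsum c N <= rsum c.
Proof.
move=> c0 cs; apply: nondecreasing_cvgn_le; first exact: zsum_nondecr.
by apply/cvg_ex; exists (rsum c); exact: rsum_cvg.
Qed.

Lemma rsum_le c (M : R) : (forall N, zsum c N <= M) -> absummable c -> rsum c <= M.
Proof.
move=> cM cs; apply: limr_le; last by exists 0%N => // N _; exact: cM.
by apply/cvg_ex; exists (rsum c); exact: rsum_cvg.
Qed.

Lemma term_le_rsum c n : (forall n, 0 <= c n) -> absummable c -> c n <= rsum c.
Proof.
move=> c0 cs.
have [N cN] : exists N, c n <= zsum c N.
  case: n => k; exists k.+1; rewrite zsumS.
    by have := zsum_ge0 k c0; have := c0 (Negz k); lra.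
  by have := zsum_ge0 k c0; have := c0 (Posz k); lra.
by apply: le_trans cN _; exact: zsum_le_rsum.
Qed.

Lemma rsum_ge0 c : (forall n, 0 <= c n) -> absummable c -> 0 <= rsum c.
Proof. by move=> c0 cs; apply: le_trans (c0 0) _; exact: term_le_rsum. Qed.

Lemma ler_rsum c d : (forall n, c n <= d n) -> absummable c -> absummable d ->
  rsum c <= rsum d.
Proof.
move=> cd cs ds; rewrite -subr_ge0.
have nds : absummable (fun n => - c n) by apply: absummable_le cs => n; rewrite normrN.
rewrite (_ : _ - _ = rsum (fun n => d n - c n)).
  by apply: rsum_ge0 => [n|]; [rewrite subr_ge0 | exact: absummableD].
rewrite (rsumD ds nds); congr (_ + _).
by rewrite -mulN1r -rsumZ//; congr rsum; apply/funext => n; rewrite mulN1r.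
Qed.

Lemma zsum_succ c N :
  zsum (fun n => c (n + 1)) N = zsum c N + (c N%:Z - c (- N%:Z)).
Proof.
elim: N => [|N IH]; first by rewrite !zsum0 oppr0 subrr addr0.
rewrite !zsumS IH NegzE.
rewrite (_ : N%:Z + 1 = N.+1%:Z); last by rewrite -addn1 PoszD.
rewrite (_ : - N.+1%:Z + 1 = - N%:Z); last by rewrite -addn1 PoszD opprD addrNK.
by ring.
Qed.

Lemma zsum_pred c N :
  zsum (fun n => c (n - 1)) N = zsum c N - (c (N%:Z - 1) - c (- N%:Z - 1)).
Proof.
have := zsum_succ (fun n => c (n - 1)) N.
rewrite (_ : (fun n => c (n + 1 - 1)) = c); last by apply/funext => n; rewrite addrK.
by move=> ->; rewrite addrK.
Qed.

Lemma absummable_succ c : absummable c -> absummable (fun n => c (n + 1)).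
Proof.
move=> [M cM]; exists M => N; rewrite (zsum_succ (fun n => `|c n|)).
apply: le_trans (cM N.+1); rewrite zsumS.
by have := normr_ge0 (c (- N%:Z)); have := normr_ge0 (c (Negz N)); lra.
Qed.

Lemma absummable_pred c : absummable c -> absummable (fun n => c (n - 1)).
Proof.
move=> [M cM]; exists M => N; rewrite (zsum_pred (fun n => `|c n|)).
apply: le_trans (cM N.+1); rewrite zsumS NegzE.
rewrite (_ : - N%:Z - 1 = - N.+1%:Z); last by rewrite -addn1 PoszD opprD.
by have := normr_ge0 (c (N%:Z - 1)); have := normr_ge0 (c (Posz N)); lra.
Qed.

Lemma absummable_cvg0 c : absummable c ->
  (fun N : nat => c (Posz N)) @ \oo --> (0 : R) /\
  (fun N : nat => c (- N%:Z)) @ \oo --> (0 : R).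
Proof.
move=> cs; have as_ : absummable (fun n => `|c n|).
  by apply: absummable_le cs => n; rewrite normr_id.
have t0 : zterm (fun n => `|c n|) @ \oo --> (0 : R).
  apply: cvg_series_cvg_0; rewrite -zsum_series.
  by apply/cvg_ex; exists (rsum (fun n => `|c n|)); exact: rsum_cvg.
split; last rewrite -cvg_shiftS /=; apply/norm_cvg0P;
  apply: (@squeeze_cvgr _ _ _ _ (fun=> 0) (zterm (fun n => `|c n|))) => //;
  try exact: cvg_cst; exists 0%N => // k _; rewrite /zterm normr_ge0/=.
  by rewrite lerDl.
by rewrite -NegzE lerDr.
Qed.

Lemma rsum_succ c : absummable c -> rsum (fun n => c (n + 1)) = rsum c.
Proof.
move=> cs; apply: rsum_lim.
have [c1 c2] := absummable_cvg0 cs.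
rewrite (_ : zsum _ = zsum c \+ ((fun N : nat => c (Posz N)) \- (fun N : nat => c (- N%:Z)))); last first.
  by apply/funext => N; exact: zsum_succ.
rewrite -[X in _ --> X]addr0 -[X in _ + X](subrr 0).
by apply: cvgD; [exact: rsum_cvg | exact: cvgB].
Qed.

Lemma rsum_pred c : absummable c -> rsum (fun n => c (n - 1)) = rsum c.
Proof.
move=> /absummable_pred /rsum_succ <-; congr rsum.
by apply/funext => n; rewrite addrK.
Qed.

Lemma rsum_single c : (forall n, n != 0 -> c n = 0) -> rsum c = c 0.
Proof.
move=> c0; apply: rsum_lim; rewrite -cvg_shiftS /=.
rewrite (_ : (fun n => _) = fun=> c 0); first exact: cvg_cst.
apply/funext => N; elim: N => [|N IH].
  by rewrite zsumS zsum0 add0r (c0 (Negz 0)) ?addr0.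
by rewrite zsumS IH (c0 (Posz N.+1))// (c0 (Negz N.+1))// !addr0.
Qed.

End IntSums.

(** * Positivity on finite sequences *)

(** X^n - 1 splits over [R[i]] and is separable in characteristic 0, so there are n distinct roots
    of unity, and they form a cyclic group. *)
Lemma complex_prim_root (R : rcfType) n : (0 < n)%N ->
  exists w : R[i], n.-primitive_root w.
Proof.
move=> n_gt0; pose p : {poly R[i]} := 'X^n - 1.
have [r Dp] := closed_field_poly_normal p.
rewrite (monicP _) ?monicXnsubC // scale1r in Dp.
have rn1 : all n.-unity_root r.
  by apply/allP=> z; rewrite -root_prod_XsubC -Dp.
have sz_r : (n < (size r).+1)%N.
  by rewrite -(size_prod_XsubC r id) -Dp size_XnsubC.
have [|z] := hasP (has_prim_root n_gt0 rn1 _ sz_r); last by exists z.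
by rewrite -separable_prod_XsubC -Dp separable_Xn_sub_1 // pnatr_eq0 -lt0n.
Qed.

Section RootsOfUnity.
Variables (R : realType) (H : hilbertType R).
Variables (N : nat) (w : R[i]).
Hypotheses (N0 : (0 < N)%N) (wP : N.-primitive_root w).

Lemma csq_prim_root : csq w = 1.
Proof.
have := congr1 (@csq R) (prim_expr_order wP); rewrite csqX csq1 => /eqP.
by rewrite pexpr_eq1 ?csq_ge0// => /eqP.
Qed.

Lemma prim_root_conj : Num.conj w = w^-1.
Proof.
have w0 : w != 0 by rewrite -csq_eq0 csq_prim_root oner_eq0.
by rewrite invC_norm -csq_normE csq_prim_root rmorph1 invr1 mul1r.
Qed.

Lemma prim_root_sum i j : (i < N)%N -> (j < N)%N ->
  \sum_(k < N) (w ^+ k) ^+ i * Num.conj ((w ^+ k) ^+ j) =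
  if i == j then N%:R else 0.
Proof.
move=> iN jN.
have w0 : w != 0 by rewrite -csq_eq0 csq_prim_root oner_eq0.
have E k : (w ^+ k) ^+ i * Num.conj ((w ^+ k) ^+ j) = (w ^+ i / w ^+ j) ^+ k.
  by rewrite !rmorphXn /= prim_root_conj exprMn !exprVn -!exprM !(mulnC k).
under eq_bigr do rewrite E.
have [<-|ij] := eqVneq i j.
  rewrite divff ?expf_neq0//; under eq_bigr do rewrite expr1n.
  by rewrite sumr_const card_ord.
set q := w ^+ i / w ^+ j.
have q1 : q != 1.
  apply: contra ij => /eqP q1; have : w ^+ i == w ^+ j.
    by rewrite -[w ^+ j]mul1r -q1 divfK// expf_neq0.
  by rewrite (eq_prim_root_expr wP) !modn_small.
have : (q - 1) * \sum_(k < N) q ^+ k = 0.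
  rewrite -subrX1 /q exprMn exprVn -!exprM ![(_ * N)%N]mulnC !exprM.
  by rewrite (prim_expr_order wP) !expr1n divr1 subrr.
by move/eqP; rewrite mulf_eq0 subr_eq0 (negPf q1) => /eqP.
Qed.

Definition dft m (a : nat -> H) k : H := \sum_(n < m) (w ^+ k) ^+ n *: a n.

(** Parseval's identity by orthogonality of characters. The bounds on m and m' exclude wrap-around,
    so distinct indices stay distinct modulo N. *)
Lemma dft_rdot m m' (a b : nat -> H) : (m <= N)%N -> (m' <= N)%N ->
  \sum_(k < N) rdot (dft m a k) (dft m' b k) =
  N%:R * \sum_(n < m) \sum_(l < m' | n == l :> nat) rdot (a n) (b l).
Proof.
move=> mN m'N; have rP := rdot_form H.
transitivity (\sum_(k < N) \sum_(n < m) \sum_(l < m')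
    rdot (((w ^+ k) ^+ n * Num.conj ((w ^+ k) ^+ l)) *: a n) (b l)).
  apply: eq_bigr => k _; rewrite (rf_suml rP); apply: eq_bigr => n _.
  rewrite (rf_sumr rP); apply: eq_bigr => l _.
  by rewrite mulrC -scalerA [RHS](rf_conj rP) conjCK.
have E (n : 'I_m) (l : 'I_m') :
    \sum_(k < N) rdot (((w ^+ k) ^+ n * Num.conj ((w ^+ k) ^+ l)) *: a n) (b l) =
    if n == l :> nat then N%:R * rdot (a n) (b l) else 0.
  rewrite -(rf_suml rP) -scaler_suml prim_root_sum; last 2 first.
  - exact: leq_trans (ltn_ord n) mN.
  - exact: leq_trans (ltn_ord l) m'N.
  case: ifP => _; last by rewrite scale0r (rf0l rP).
  by rewrite -(rfZl rP) rmorph_nat.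
rewrite exchange_big mulr_sumr; under eq_bigr => n _ do
  (rewrite exchange_big; under eq_bigr => l _ do rewrite E); rewrite /=.
by under [RHS]eq_bigr => n _ do rewrite mulr_sumr big_mkcond.
Qed.

End RootsOfUnity.

Section ToeplitzPositive.
Variables (R : realType) (H : hilbertType R) (S : H -> H) (rho eps : R).
Hypothesis S_lin : linear S.
Hypothesis S_pos : forall (z : R[i]) x, csq z = 1 ->
  eps * nsq x <= qform rho (z *: S x) x.

(* Averages the hypothesis over the vectors sum_n w^(kn) x_n, w a primitive
   (m+1)-th root of unity: orthogonality leaves only the diagonal and the first
   subdiagonal. *)
Lemma toeplitz_ge0 (m : nat) (x : nat -> H) :
  0 <= \sum_(n < m) ((rho - eps) * nsq (x n) + (rho - 2) * nsq (S (x n)))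
     - 2 * (rho - 1) * \sum_(n < m) (if (n.+1 < m)%N then rdot (S (x n)) (x n.+1) else 0).
Proof.
have rP := rdot_form H.
have [w wP] := @complex_prim_root R m.+1 isT.
pose X k := dft w m x k.
(* Multiplying by w^k moves the sequence S x one place to the right. It then has m + 1 entries,
   hence a root of unity of order m + 1. *)
pose y n := if n is n'.+1 then S (x n') else 0.
have SX k : S (X k) = dft w m (S \o x) k.
  by rewrite /X /dft (lin_sum S_lin); apply: eq_bigr => n _; rewrite (linZ S_lin).
have wSX k : w ^+ k *: S (X k) = dft w m.+1 y k.
  rewrite SX /dft big_ord_recl /= scaler0 add0r scaler_sumr.
  by apply: eq_bigr => n _; rewrite scalerA -exprS.
have diag (a : nat -> H) : \sum_(k < m.+1) nsq (dft w m a k) =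
    m.+1%:R * \sum_(n < m) nsq (a n).
  rewrite (dft_rdot _ wP)//; congr (_ * _); apply: eq_bigr => n _.
  rewrite (bigD1 n)//= big1 ?addr0// => l /andP[/eqP nl].
  by rewrite -val_eqE /= nl eqxx.
have cross : \sum_(k < m.+1) rdot (dft w m.+1 y k) (dft w m x k) =
    m.+1%:R * \sum_(n < m) (if (n.+1 < m)%N then rdot (S (x n)) (x n.+1) else 0).
  rewrite (dft_rdot _ wP)//; congr (_ * _); rewrite big_ord_recl /= big1 => [|l _]; last first.
    by rewrite (rf0l rP).
  rewrite add0r; apply: eq_bigr => n _; rewrite /bump leq0n add1n.
  case: ifP => nm.
    rewrite (bigD1 (Ordinal nm))//= big1 ?addr0// => l /andP[/eqP nl].
    by rewrite -val_eqE /= -nl eqxx.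
  rewrite big1// => l /eqP nl; exfalso.
  by have := ltn_ord l; rewrite -nl nm.
have : 0 <= \sum_(k < m.+1) (qform rho (w ^+ k *: S (X k)) (X k) - eps * nsq (X k)).
  apply: sumr_ge0 => k _; rewrite subr_ge0; apply: S_pos.
  by rewrite csqX (csq_prim_root _ wP)// expr1n.
rewrite (_ : \sum_(k < m.+1) _ = m.+1%:R * (\sum_(n < m) ((rho - eps) * nsq (x n) + (rho - 2) * nsq (S (x n)))
     - 2 * (rho - 1) * \sum_(n < m) (if (n.+1 < m)%N then rdot (S (x n)) (x n.+1) else 0))).
  by rewrite pmulr_rge0// ltr0n.
transitivity (\sum_(k < m.+1) ((rho - eps) * nsq (dft w m x k)
   + (rho - 2) * nsq (dft w m (S \o x) k)
   - 2 * (rho - 1) * rdot (dft w m.+1 y k) (dft w m x k))).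
  apply: eq_bigr => k _; rewrite /qform -wSX -SX (rf_scale2 rP) csqX (csq_prim_root _ wP)// expr1n.
  by rewrite /X; ring.
rewrite big_split sumrN -!mulr_sumr big_split -!mulr_sumr !diag cross /=.
by rewrite big_split -!mulr_sumr /=; ring.
Qed.

Lemma sum_zsum (F : int -> R) n : \sum_(k < n.*2) F (k%:Z - n%:Z) = zsum F n.
Proof.
elim: n F => [|n IH] F; first by rewrite big_ord0 zsum0.
rewrite doubleS big_ord_recr big_ord_recl /= zsumS -IH.
rewrite (_ : 0%Z - n.+1%:Z = Negz n); last by rewrite NegzE sub0r.
rewrite (_ : (n.*2.+1)%:Z - n.+1%:Z = n%:Z); last by lia.
rewrite (eq_bigr (fun k : 'I_(n.*2) => F (k%:Z - n%:Z))); last first.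
  by move=> k _; congr F; rewrite /bump; lia.
by ring.
Qed.

Lemma sum_zsum_succ (F : int -> R) n :
  \sum_(k < n.*2) (if (k.+1 < n.*2)%N then F (k%:Z - n%:Z) else 0) =
  zsum F n - (if n is n'.+1 then F n'%:Z else 0).
Proof.
case: n => [|n]; first by rewrite big_ord0 zsum0 subr0.
rewrite -sum_zsum doubleS !big_ord_recr /= ltnn addr0.
rewrite (_ : (n.*2.+1)%:Z - n.+1%:Z = n%:Z); last by lia.
rewrite addrK ltnSn; congr (_ + _).
by apply: eq_bigr => k _; rewrite ltnS ltnW ?ltnS.
Qed.

(** The window -n <= k < n has 2n vertices but only 2n - 1 inner links; the link from n - 1 to n
    leaves it and is subtracted. *)
Lemma zsum_qform_ge0 (g : int -> H) n :
  0 <= zsum (fun k => (rho - eps) * nsq (g k) + (rho - 2) * nsq (S (g k))) n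
     - 2 * (rho - 1) * (zsum (fun k => rdot (S (g k)) (g (k + 1))) n -
          (if n is n'.+1 then rdot (S (g n'%:Z)) (g (n'%:Z + 1)) else 0)).
Proof.
have := toeplitz_ge0 n.*2 (fun k => g (k%:Z - n%:Z)).
rewrite (sum_zsum (fun k => (rho - eps) * nsq (g k) + (rho - 2) * nsq (S (g k)))).
rewrite (eq_bigr (fun k : 'I_(n.*2) => if (k.+1 < n.*2)%N then
    rdot (S (g (k%:Z - n%:Z))) (g (k%:Z - n%:Z + 1)) else 0)); last first.
  by move=> k _; case: ifP => // _; congr (rdot _ (g _)); lia.
by rewrite (sum_zsum_succ (fun k => rdot (S (g k)) (g (k + 1)))).
Qed.

End ToeplitzPositive.

(** * Square-summable sequences *)

Section SquareSummable.
Variables (R : realType) (H : hilbertType R).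
Implicit Types g h : int -> H.
Let rP := rdot_form H.

(** Made boolean so that the submodule and subtype structures of [l2seq] can be derived from it. *)
Definition square_summable g : bool := `[< absummable (fun n => nsq (g n)) >].

Lemma square_summableP g : square_summable g <-> absummable (fun n => nsq (g n)).
Proof. by split=> /asboolP. Qed.

Lemma square_summable_le g h (C : R) : (forall n, nsq (h n) <= C * nsq (g n)) ->
  square_summable g -> square_summable h.
Proof.
move=> hg /square_summableP gs; apply/square_summableP.
apply: (absummable_le _ (absummableZ C gs)) => n.
by rewrite !ger0_norm ?(rf_ge0 rP)//; apply: le_trans (hg n); exact: rf_ge0 rP _.
Qed.

Lemma square_summableD g h : square_summable g -> square_summable h ->
  square_summable (fun n => g n + h n).
Proof.
move=> /square_summableP gs /square_summableP hs; apply/square_summableP.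
apply: (absummable_le _ (absummableD (absummableZ 2 gs) (absummableZ 2 hs))) => n.
rewrite !ger0_norm ?addr_ge0 ?mulr_ge0 ?(rf_ge0 rP)//.
exact: rf_sqD_le.
Qed.

Lemma square_summableZ (c : R[i]) g : square_summable g ->
  square_summable (fun n => c *: g n).
Proof. by apply: (@square_summable_le g _ (csq c)) => n; rewrite (rf_scale2 rP). Qed.

Fact square_summable_submod : submod_closed square_summable.
Proof.
split.
  apply/square_summableP; exists 0 => N; rewrite /zsum big1// => k _.
  by rewrite /zterm (rf0l rP) normr0 addr0.
move=> c g h gs hs; apply: square_summableD => //; exact: square_summableZ.
Qed.

HB.instance Definition _ := GRing.isSubmodClosed.Build R[i] (int -> H)
  square_summable square_summable_submod.

Record l2seq := L2seq { l2val :> int -> H ; _ : square_summable l2val }.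

HB.instance Definition _ := [isSub for l2val].
HB.instance Definition _ := [Choice of l2seq by <:].
HB.instance Definition _ := [SubChoice_isSubLmodule of l2seq by <:].

Lemma l2seqP (g : l2seq) : absummable (fun n => nsq (g n)).
Proof. by apply/square_summableP; case: g. Qed.

Lemma l2seqD (g h : l2seq) n : (g + h) n = g n + h n.
Proof. by []. Qed.

Lemma l2seqB (g h : l2seq) n : (g - h) n = g n - h n.
Proof. by []. Qed.

Lemma l2seqZ c (g : l2seq) n : (c *: g) n = c *: g n.
Proof. by []. Qed.

Lemma l2seq_ext (g h : l2seq) : (forall n, g n = h n) -> g = h.
Proof. by move=> gh; apply: val_inj; apply/funext. Qed.

Definition l2dot (g h : l2seq) : R := rsum (fun n => rdot (g n) (h n)).

Lemma l2dot_absummable (g h : l2seq) : absummable (fun n => rdot (g n) (h n)).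
Proof.
apply: (absummable_le _ (absummableD (l2seqP g) (l2seqP h))) => n.
rewrite [X in _ <= X]ger0_norm ?addr_ge0 ?(rf_ge0 rP)//.
have := rf_amgm rP (g n) (h n); have := normr_ge0 (rdot (g n) (h n)); lra.
Qed.

Lemma l2dot_form : real_form l2dot.
Proof.
split.
- move=> g g' h; rewrite -rsumD; [|exact: l2dot_absummable..].
  by congr rsum; apply/funext => n; rewrite l2seqD (rfDl rP).
- move=> a g h; rewrite -rsumZ; last exact: l2dot_absummable.
  by congr rsum; apply/funext => n; rewrite l2seqZ (rfZl rP).
- by move=> g h; congr rsum; apply/funext => n; rewrite (rfC rP).
- by move=> g h; congr rsum; apply/funext => n; rewrite !l2seqZ (rfI rP).
- by move=> g; apply: rsum_ge0 => [n|]; [exact: rf_ge0 rP _ | exact: l2seqP].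
Qed.

Lemma l2dot_term (g : l2seq) n : nsq (g n) <= l2dot g g.
Proof.
apply: (@term_le_rsum _ (fun n => nsq (g n))); last exact: l2seqP.
by move=> m; exact: rf_ge0 rP _.
Qed.

Lemma l2dot_eq0 (g : l2seq) : l2dot g g = 0 -> g = 0.
Proof.
move=> g0; apply: l2seq_ext => n; apply/eqP; rewrite -nsq_eq0 eq_le.
by rewrite (rf_ge0 rP) andbT -g0 l2dot_term.
Qed.

(** The limit is taken coordinatewise. On a finite window it is approximated by some y in the same
    small set as x, which bounds l - x there uniformly in the window. *)
Lemma l2dot_complete (F : set_system l2seq) : ProperFilter F ->
  (forall e : R, 0 < e ->
     exists2 A, F A & forall x y, A x -> A y -> l2dot (x - y) (x - y) < e) ->
  exists l : l2seq, forall e : R, 0 < e -> F [set x | l2dot (l - x) (l - x) < e].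
Proof.
move=> FF cF.
have /choice[l lP] (n : int) : exists v : H, forall e : R, 0 < e ->
    F [set x : l2seq | nsq (v - x n) < e].
  apply: (@hilbert_complete _ _ ((fun x : l2seq => x n) @ F)) => e e0.
  have [A FA hA] := cF e e0; exists [set x n | x in A].
    by apply: (@filterS _ F _ A) => // x Ax; exists x.
  move=> _ _ [x Ax <-] [y Ay <-]; rewrite -l2seqB.
  by apply: le_lt_trans (l2dot_term _ _) _; exact: hA.
have near (e : R) : 0 < e -> exists2 A, F A & forall (x : l2seq) N, A x ->
    zsum (fun n => nsq (l n - x n)) N <= e.
  move=> e0; have e4 : 0 < e / 4 by rewrite divr_gt0.
  have [A FA hA] := cF _ e4; exists A => // x N Ax.
  (* The 2N coordinates of the window contribute at most 2 N d <= e / 4 to |l - y|^2. With |y - x|^2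
     < e / 4 and |a + b|^2 <= 2 |a|^2 + 2 |b|^2 the total is at most e. *)
  pose d := e / (8 * N.+1%:R).
  have d0 : 0 < d by rewrite divr_gt0// mulr_gt0// ltr0n.
  have Fd M : F [set y : l2seq | zsum (fun n => nsq (l n - y n)) M <= M%:R * (2 * d)].
    elim: M => [|M IH]; first by apply: filterS filterT => y _ /=; rewrite zsum0 mul0r.
    apply: filterS (filterI IH (filterI (lP (Posz M) _ d0) (lP (Negz M) _ d0))).
    move=> y [/= h1 [h2 h3]]; rewrite zsumS -natr1; lra.
  have [y [Ay /= yd]] : exists y, (A `&` [set y : l2seq |
      zsum (fun n => nsq (l n - y n)) N <= N%:R * (2 * d)]) y.
    by apply: (@filter_ex _ F); exact: filterI.
  have xy := hA _ _ Ay Ax.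
  have h1 : zsum (fun n => nsq (l n - x n)) N <=
      2 * zsum (fun n => nsq (l n - y n)) N + 2 * zsum (fun n => nsq ((y - x) n)) N.
    rewrite -!zsumZ -zsumD; apply: ler_zsum => n; rewrite l2seqB.
    by rewrite -[X in rdot X _](subrKA (y n)) -[X in rdot _ X](subrKA (y n)) rf_sqD_le.
  have h2 : zsum (fun n => nsq ((y - x) n)) N <= e / 4.
    apply: le_trans (ltW xy); apply: zsum_le_rsum; last exact: l2seqP.
    by move=> n; exact: rf_ge0 rP _.
  have h3 : N%:R * (2 * d) <= e / 4.
    rewrite /d [X in _ <= X](_ : _ = N.+1%:R * (2 * (e / (8 * N.+1%:R)))).
      apply: ler_wpM2r; last by rewrite ler_nat.
      by apply: mulr_ge0 => //; exact: ltW d0.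
    by field; rewrite gt_eqF//; have := ler0n R N; lra.
  lra.
have ls : square_summable l.
  have [A FA hA] := near 1 ltr01.
  have [x Ax] := filter_ex FA.
  have lxs : square_summable (fun n => l n - x n).
    apply/square_summableP; apply: (@absummableP _ _ 1) => [n|N]; last exact: hA.
    exact: rf_ge0 rP _.
  rewrite (_ : l = fun n => (l n - x n) + x n).
    by apply: square_summableD => //; case: (x).
  by apply/funext => n; rewrite subrK.
exists (L2seq ls) => e e0; have e2 : 0 < e / 2 by rewrite divr_gt0.
have [A FA hA] := near _ e2.
apply: filterS FA => x Ax /=; apply: (@le_lt_trans _ _ (e / 2)).
  by apply: rsum_le; [move=> N; exact: hA | exact: l2seqP].
by rewrite ltr_pdivrMr// ltr_pMr// ltr1n.
Qed.

End SquareSummable.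

(** * Construction of the dilation *)

Lemma bounded_opP (R : realType) (H K : hilbertType R) (f : H -> K) (C : R) :
  linear f -> (forall x, nsq (f x) <= C * nsq x) -> bounded_op f.
Proof.
move=> fl fC; split=> // x; apply/cvgrPdist_lt => e e0.
have [r r0 ->] : exists2 r : R, 0 < r & e = r%:C.
  by case: e e0 => a b; rewrite ltcE /= => /andP[/eqP -> a0]; exists a.
(* As [|C|] <= ([|C|] + 1)^2, this radius serves without a square root and without a sign for C. *)
pose d : R := r / (`|C| + 1).
have C1 : 0 < `|C| + 1 by rewrite ltr_pwDr.
have C2 : `|C| < (`|C| + 1) ^+ 2 by have := normr_ge0 C; nra.
have d0 : 0 < d by rewrite divr_gt0.
have dC : 0 < d%:C by rewrite ltcR.
apply/nbhs_ballP; exists d%:C => //= y; rewrite -ball_normE /= !norm_lt_nsq// => xy.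
rewrite -(linB fl); apply: le_lt_trans (fC _) _.
have n0 := rf_ge0 (rdot_form H) (x - y).
apply: (@le_lt_trans _ _ ((`|C| + 1) ^+ 2 * nsq (x - y))).
  by rewrite ler_wpM2r// (le_trans (ler_norm _))// ltW.
rewrite -ltr_pdivlMl ?exprn_gt0//; apply: lt_le_trans xy _.
by rewrite /d expr_div_n mulrC.
Qed.

Section Dilation.
Variables (R : realType) (H : hilbertType R) (S : H -> H) (rho eps C t : R).
Hypotheses (rho_ge1 : 1 <= rho) (eps_gt0 : 0 < eps).
Hypotheses (t_ge0 : 0 <= t) (t_lt1 : t < 1).
Hypothesis S_lin : linear S.
Hypothesis S_pow : forall n x, nsq (iter n S x) <= C * t ^+ n * nsq x.
Hypothesis S_pos : forall (z : R[i]) x, csq z = 1 ->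
  eps * nsq x <= qform rho (z *: S x) x.
Let rP := rdot_form H.
Let lP := l2dot_form H.
Local Notation L2 := (l2seq H).

Let rho_gt0 : 0 < rho. Proof. exact: lt_le_trans ltr01 rho_ge1. Qed.

Let S_bound x : nsq (S x) <= C * t * nsq x.
Proof. exact: (S_pow 1). Qed.

Let S0 : S 0 = 0. Proof. exact: lin0. Qed.

Lemma shift_summable (g : L2) : square_summable (fun n => g (n + 1)).
Proof. apply/square_summableP; exact: absummable_succ (l2seqP g). Qed.

Lemma unshift_summable (g : L2) : square_summable (fun n => g (n - 1)).
Proof. apply/square_summableP; exact: absummable_pred (l2seqP g). Qed.

Definition shift (g : L2) : L2 := L2seq (shift_summable g).
Definition unshift (g : L2) : L2 := L2seq (unshift_summable g).

Lemma lmap_summable (g : L2) : square_summable (S \o g).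
Proof.
apply: (@square_summable_le _ _ g _ (C * t)) => [n|]; first exact: S_bound.
by case: g.
Qed.

Definition lmap (g : L2) : L2 := L2seq (lmap_summable g).

Definition defect (g : L2) : L2 := g - lmap (unshift g).

Definition dil_form (g h : L2) : R := rho^-1 *
  ((rho - 2) * l2dot (defect g) (defect h) + l2dot g (defect h) + l2dot (defect g) h).

Lemma shift_linear : linear shift.
Proof. by move=> c g h; apply: l2seq_ext. Qed.

Lemma unshift_linear : linear unshift.
Proof. by move=> c g h; apply: l2seq_ext. Qed.

Lemma shiftK : cancel shift unshift.
Proof. by move=> g; apply: l2seq_ext => n /=; rewrite subrK. Qed.

Lemma unshiftK : cancel unshift shift.
Proof. by move=> g; apply: l2seq_ext => n /=; rewrite addrK. Qed.

Lemma lmap_linear : linear lmap.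
Proof. by move=> c g h; apply: l2seq_ext => n; exact: S_lin. Qed.

Lemma defect_linear : linear defect.
Proof.
move=> c g h; rewrite /defect unshift_linear lmap_linear scalerBr.
by rewrite opprD addrACA.
Qed.

Lemma l2dot_shift g h : l2dot (shift g) (shift h) = l2dot g h.
Proof. exact: rsum_succ (l2dot_absummable g h). Qed.

Lemma l2dot_unshift g h : l2dot (unshift g) (unshift h) = l2dot g h.
Proof. exact: rsum_pred (l2dot_absummable g h). Qed.

Lemma defect_shift g : defect (shift g) = shift (defect g).
Proof.
apply: l2seq_ext => n.
change (g (n + 1) - S (g (n - 1 + 1)) = g (n + 1) - S (g (n + 1 - 1))).
by rewrite subrK addrK.
Qed.

Lemma l2dot_lmap g : l2dot (lmap g) (lmap g) <= C * t * l2dot g g.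
Proof.
rewrite /l2dot -rsumZ; last exact: l2seqP.
apply: ler_rsum => [n||]; [exact: S_bound | exact: l2seqP |].
exact: absummableZ (l2seqP g).
Qed.

(** The expansion that leads from (rho - 2) |h|^2 + 2 Re <x, h> to [qform], with the shift in place
    of z. Shift invariance puts the cross term on the links <S g_n, g_(n+1)> of [zsum_qform_ge0]. *)
Lemma dil_formE g : rho * dil_form g g = rho * l2dot g g
  - 2 * (rho - 1) * l2dot (lmap g) (shift g) + (rho - 2) * l2dot (lmap g) (lmap g).
Proof.
rewrite /dil_form mulVKf ?gt_eqF// /defect (rf_sqB lP) (rfBl lP) (rfBr lP).
have -> : l2dot (lmap (unshift g)) (lmap (unshift g)) = l2dot (lmap g) (lmap g).
  by rewrite -(l2dot_unshift (lmap g)); congr l2dot; exact: l2seq_ext.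
have -> : l2dot g (lmap (unshift g)) = l2dot (lmap g) (shift g).
  rewrite (rfC lP) -l2dot_shift; congr l2dot.
  by apply: l2seq_ext => n; rewrite /= addrK.
have -> : l2dot (lmap (unshift g)) g = l2dot (lmap g) (shift g).
  rewrite -l2dot_shift; congr l2dot.
  by apply: l2seq_ext => n; rewrite /= addrK.
by ring.
Qed.

(** The limit of the finite windows: the link that leaves the window tends to 0, being the general
    term of an absolutely summable sequence. *)
Lemma dil_form_ge g : eps * l2dot g g <= rho * dil_form g g.
Proof.
rewrite dil_formE -subr_ge0.
pose w n := rdot (S (g n)) (g (n + 1)).
have ws : absummable w by exact: (l2dot_absummable (lmap g) (shift g)).
have gs := l2seqP g; have Sgs := l2seqP (lmap g).
pose q n := (rho - eps) * nsq (g n) + (rho - 2) * nsq (S (g n)).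
have qs : absummable q by apply: absummableD; exact: absummableZ.
have qE : rsum q = (rho - eps) * l2dot g g + (rho - 2) * l2dot (lmap g) (lmap g).
  by rewrite /q rsumD ?rsumZ//; exact: absummableZ.
pose v N : R := zsum q N.+1 - 2 * (rho - 1) * (zsum w N.+1 - w (Posz N)).
have vl : v @ \oo --> rsum q - 2 * (rho - 1) * (rsum w - 0).
  apply: cvgB; first by rewrite (cvg_shiftS (zsum q)); exact: rsum_cvg.
  apply: cvgMr; apply: cvgB; first by rewrite (cvg_shiftS (zsum w)); exact: rsum_cvg.
  by have [] := absummable_cvg0 ws.
rewrite (_ : _ - _ = rsum q - 2 * (rho - 1) * (rsum w - 0)).
  rewrite -(cvg_lim _ vl)//; apply: limr_ge; first by apply/cvg_ex; eexists; exact: vl.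
  by exists 0%N => // N _; exact: (zsum_qform_ge0 S_lin S_pos g N.+1).
by rewrite qE subr0 /w -/(l2dot (lmap g) (shift g)); ring.
Qed.

Lemma dil_form_le : exists C' : R, forall g, dil_form g g <= C' * l2dot g g.
Proof.
(* From 2 <g, Dg> <= |g|^2 + |Dg|^2, which raises the coefficient rho - 2 of |Dg|^2 to rho - 1, and
   |Dg|^2 <= (2 + 2 C t) |g|^2. *)
pose D := rho^-1 * ((rho - 1) * (2 + 2 * (C * t)) + 1).
exists D => g; rewrite /D -mulrA /dil_form ler_wpM2l ?invr_ge0 ?(ltW rho_gt0)//.
have h1 := l2dot_lmap (unshift g); rewrite l2dot_unshift in h1.
have h2 := rf_ge0 lP (g - defect g); rewrite (rf_sqB lP) in h2.
rewrite [l2dot (defect g) g](rfC lP).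
have h3 : l2dot (defect g) (defect g) <= (2 + 2 * (C * t)) * l2dot g g.
  by apply: le_trans (rf_sqB_le lP _ _) _; lra.
have h4 : (rho - 1) * l2dot (defect g) (defect g) <=
    (rho - 1) * ((2 + 2 * (C * t)) * l2dot g g).
  by rewrite ler_wpM2l// subr_ge0.
move: h2 h4; generalize (l2dot g g) (l2dot (defect g) (defect g)) (l2dot g (defect g)).
move=> p q s; lra.
Qed.

Lemma dil_hilbert_form : hilbert_form dil_form.
Proof.
have ge0 g : 0 <= dil_form g g.
  rewrite -(pmulr_rge0 _ rho_gt0); apply: le_trans (dil_form_ge g).
  by rewrite mulr_ge0 ?(rf_ge0 lP)// ltW.
split.
- split=> //.
  + move=> g g' h; rewrite /dil_form (linD defect_linear) !(rfDl lP); ring.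
  + move=> a g h; rewrite /dil_form (linZ defect_linear) !(rfZl lP); ring.
  + move=> g h; rewrite /dil_form (rfC lP (defect g)) (rfC lP g) (rfC lP (defect g) h); ring.
  + by move=> g h; rewrite /dil_form !(linZ defect_linear) !(rfI lP).
- move=> g g0; apply: l2dot_eq0; apply/eqP; rewrite eq_le (rf_ge0 lP) andbT.
  rewrite -(pmulr_rle0 _ eps_gt0); apply: le_trans (dil_form_ge g) _.
  by rewrite g0 mulr0.
move=> F FF cF; have [C' dC'] := dil_form_le.
(* The lower bound makes a Cauchy filter for the form Cauchy in l2; the upper bound brings the l2
   limit back. *)
have [e e0|l Fl] := @l2dot_complete _ H F FF.
  have r0 : 0 < rho^-1 * (eps * e) by rewrite !mulr_gt0 ?invr_gt0.
  have [A FA hA] := cF _ r0; exists A => // x y Ax Ay.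
  rewrite -(ltr_pM2l eps_gt0); apply: le_lt_trans (dil_form_ge _) _.
  by rewrite -ltr_pdivlMl//; exact: hA.
exists l => e e0.
have d0 : 0 < e / (`|C'| + 1) by rewrite divr_gt0// ltr_pwDr.
apply: filterS (Fl _ d0) => x /=; rewrite ltr_pdivlMr ?ltr_pwDr// => h.
apply: le_lt_trans (dC' _) (le_lt_trans _ h).
rewrite mulrC ler_wpM2l ?(rf_ge0 lP)//.
by apply: le_trans (ler_norm _) _; rewrite lerDl.
Qed.

Local Notation K := (form_space dil_hilbert_form).

Lemma orbit_summable (x : H) :
  square_summable (fun n : int => if n is Posz k then iter k S x else 0).
Proof.
apply/square_summableP; apply: (@absummableP _ _ (C * nsq x / (1 - t))).
  by move=> n; exact: rf_ge0 rP _.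
move=> N; rewrite ler_pdivlMr ?subr_gt0//.
apply: (@le_trans _ _ (C * nsq x * (1 - t ^+ N))); last first.
  (* The case n = 0 of [S_pow] reads |x|^2 <= C |x|^2, which supplies 0 <= C |x|^2. *)
  rewrite ler_piMr//; first by apply: le_trans (rf_ge0 rP x) _; have := S_pow 0 x; rewrite expr0 mulr1.
  by rewrite gerBl exprn_ge0.
elim: N => [|N IH]; first by rewrite zsum0 mul0r expr0 subrr mulr0.
rewrite zsumS (rf0l rP) addr0 exprSr.
have := S_pow N x; move: (t ^+ N) (nsq (iter N S x)) IH => u v IH h.
have := ler_wpM2r (ltW (_ : 0 < 1 - t)) h; rewrite subr_gt0 => /(_ t_lt1); lra.
Qed.

Definition orbit (x : H) : K := L2seq (orbit_summable x).

Lemma single_summable (x : H) : square_summable (fun n : int => if n == 0 then x else 0).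
Proof.
apply/square_summableP; apply: (@absummableP _ _ (nsq x)).
  by move=> n; exact: rf_ge0 rP _.
case=> [|N]; first by rewrite zsum0 (rf_ge0 rP).
elim: N => [|N IH]; first by rewrite zsumS zsum0 /= (rf0l rP) addr0 add0r.
by rewrite zsumS /= (rf0l rP) !addr0.
Qed.

Definition single (x : H) : L2 := L2seq (single_summable x).

Lemma defect_orbit x : defect (orbit x) = single x.
Proof.
apply: l2seq_ext => n.
transitivity (orbit x n - S (orbit x (n - 1))) => //.
case: n => [[|k]|k].
- by rewrite (_ : 0%N%:Z - 1 = Negz 0)// S0 subr0.
- by rewrite (_ : k.+1%:Z - 1 = k%:Z) /= ?subrr//; lia.
- by rewrite (_ : Negz k - 1 = Negz k.+1) /= ?S0 ?subr0//; lia.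
Qed.

Lemma l2dot_single (g : L2) x : l2dot g (single x) = rdot (g 0) x.
Proof.
rewrite /l2dot rsum_single//= => n n0.
by rewrite (negPf n0) (rf0r rP).
Qed.

Lemma iter_shift n (g : L2) k : iter n shift g k = g (k + n%:Z).
Proof.
elim: n k => [|n IH] k; first by rewrite addr0.
by rewrite /= IH; congr (l2val g _); lia.
Qed.

Lemma orbit_linear : linear orbit.
Proof.
move=> c x y; apply: l2seq_ext => n.
transitivity (c *: orbit x n + orbit y n) => //.
by case: n => k /=; [exact: lin_iter | rewrite scaler0 addr0].
Qed.

(** D sends an orbit to its initial vector at position 0, and n shifts carry it to -n. For n > 0
    that position meets neither [single y] nor the support of [orbit y], so only <S^n x, y>
    survives. For n = 0 the three terms add up to (rho - 2) + 1 + 1 = rho times <x, y>. *)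
Lemma dil_form_orbit n x y : dil_form (iter n shift (orbit x)) (orbit y) =
  if n is 0%N then rdot x y else rho^-1 * rdot (iter n S x) y.
Proof.
have dE : defect (iter n shift (orbit x)) = iter n shift (single x).
  elim: n => [|n IH]; first exact: defect_orbit.
  by rewrite !iterS defect_shift IH.
rewrite /dil_form dE defect_orbit !l2dot_single !iter_shift !add0r.
case: n {dE} => [|n] /=.
  by rewrite (rfC lP) l2dot_single /= (rfC rP y); field; rewrite gt_eqF.
rewrite (rf0l rP) mulr0 add0r [X in _ + X](_ : _ = 0) ?addr0//.
rewrite -/(iter n.+1 shift _) /l2dot.
have E m : rdot (iter n.+1 shift (single x) m) (orbit y m) = 0.
  rewrite iter_shift /=; case: m => k; last by rewrite (rf0r rP).
  by rewrite (_ : _ == 0 = false) ?(rf0l rP)//; lia.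
by rewrite rsum_single// => m _; exact: E.
Qed.

Lemma dil_form_shift g h : dil_form (shift g) (shift h) = dil_form g h.
Proof. by rewrite /dil_form !defect_shift !l2dot_shift. Qed.

Lemma dilation : class_C rho S.
Proof.
have kP := rdot_form K.
have Ur (g h : K) : rdot (shift g : K) (shift h : K) = rdot g h by exact: dil_form_shift.
have Jr x y : rdot (orbit x) (orbit y) = rdot x y by exact: (dil_form_orbit 0).
(* P is the adjoint of the isometry [orbit], obtained one Riesz vector at a time. *)
have /choice[P PP] (u : K) : exists w, forall y, rdot u (orbit y) = rdot w y.
  apply: (@riesz _ _ (fun y => rdot u (orbit y)) (nsq u)).
  - by move=> x y; rewrite (linD orbit_linear) (rfDr kP).
  - by move=> a x; rewrite (linZ orbit_linear) (rfZr kP).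
  - by move=> x; apply: le_trans (rf_CS kP _ _) _; rewrite Jr.
split; first exact: bounded_opP S_lin S_bound.
exists K, orbit, P, shift; split.
- split; first exact: orbit_linear.
  by move=> x y; rewrite !innerE -(linZ orbit_linear) !Jr.
- move=> u y; rewrite innerE -(linZ orbit_linear) !(rfBl kP) !Jr !PP !subrr.
  by [].
- split; first by apply: (@bounded_opP _ K K shift 1 shift_linear) => g; rewrite mul1r Ur.
  exists unshift; split.
  + apply: (@bounded_opP _ K K unshift 1 unshift_linear) => g.
    by rewrite mul1r -Ur unshiftK.
  + move=> g h; rewrite !innerE -{1 2}[h]unshiftK.
    by rewrite -(linZ shift_linear) !Ur.
  + exact: shiftK.
  + exact: unshiftK.
move=> n n0 x; apply: rdot_inj => y; rewrite (rfZl rP) -PP.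
rewrite (_ : rdot _ (orbit y) = dil_form (iter n shift (orbit x)) (orbit y))//.
by rewrite dil_form_orbit; case: n n0 => // n _; rewrite mulVKf// gt_eqF.
Qed.

End Dilation.

(** * The constant *)

Section KtildeAlgebra.
Variable R : realType.
Implicit Types K rho k mu : R.

Definition kpoly rho K mu := rho * K * mu ^+ 2 - (K ^+ 2 + 1) * mu + (2 - rho) * K.

Let disc rho K := (K ^+ 2 + 1) ^+ 2 - 4 * rho * (2 - rho) * K ^+ 2.

Let disc_ge0 rho K : 0 <= disc rho K.
Proof.
have -> : disc rho K = (K ^+ 2 - 1) ^+ 2 + (2 * K * (rho - 1)) ^+ 2.
  by rewrite /disc; ring.
by rewrite addr_ge0 ?sqr_ge0.
Qed.

Let disc_kpoly rho K mu :
  (2 * rho * K * mu - (K ^+ 2 + 1)) ^+ 2 - disc rho K = 4 * rho * K * kpoly rho K mu.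
Proof. by rewrite /disc /kpoly; ring. Qed.

Lemma Ktilde_root rho K : 1 <= rho -> 1 <= K -> kpoly rho K (Ktilde K rho) = 0.
Proof.
move=> rho1 K1.
have d0 : 0 < 2 * rho * K by nra.
have : 4 * rho * K * kpoly rho K (Ktilde K rho) = 0.
  rewrite -disc_kpoly (_ : _ - (K ^+ 2 + 1) = Num.sqrt (disc rho K)).
    by rewrite sqr_sqrtr ?subrr.
  by rewrite /Ktilde mulrC divfK ?gt_eqF// addrAC subrr add0r.
by move/eqP; rewrite mulf_eq0 gt_eqF ?orFb; [move/eqP | nra].
Qed.

(** [kpoly rho K] is convex in mu with value -(K - 1)^2 <= 0 at 1, so 1 lies between its roots and
    only the larger one counts on mu >= 1. To the left of the vertex both sides are false. *)
Lemma Ktilde_lt rho K mu : 1 <= rho -> 1 <= K -> 1 <= mu ->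
  (Ktilde K rho < mu) = (0 < kpoly rho K mu).
Proof.
move=> rho1 K1 mu1.
have d0 : 0 < 2 * rho * K by nra.
have q0 : 0 < 4 * rho * K by nra.
rewrite -(pmulr_rgt0 _ q0) -disc_kpoly subr_gt0 /Ktilde ltr_pdivrMr//.
rewrite -ltrBrDl (mulrC mu) -/(disc rho K).
have [X0|X0] := ltrP 0 (2 * rho * K * mu - (K ^+ 2 + 1)).
  rewrite -[in RHS](sqr_sqrtr (disc_ge0 rho K)) ltr_sqr ?nnegrE ?sqrtr_ge0//.
  exact: ltW.
rewrite ltNge (le_trans X0 (sqrtr_ge0 _)) /=; apply/esym/negbTE.
rewrite -leNgt -subr_ge0 -opprB oppr_ge0 disc_kpoly pmulr_rle0//.
rewrite /kpoly; have h : rho * K * (mu - 1) * (mu + 1) >= 0.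
  by rewrite !mulr_ge0//; lra.
have h2 : 0 <= mu * (K ^+ 2 + 1 - 2 * rho * K * mu) by rewrite mulr_ge0//; lra.
have h3 : 0 <= (rho - 1) * K by rewrite mulr_ge0//; lra.
by nra.
Qed.

Lemma Ktilde_ge1 rho K : 1 <= rho -> 1 <= K -> 1 <= Ktilde K rho.
Proof.
move=> rho1 K1; rewrite leNgt Ktilde_lt// -leNgt /kpoly.
by have := sqr_ge0 (K - 1); nra.
Qed.

(* For k > 1 the larger root mu of [kpoly rho k] is (k + r) / (1 + k r) for a
   unique 0 <= r < 1; this r is the modulus of the Moebius parameter. *)
Lemma kpoly_param rho k mu : 1 <= rho -> 1 < k -> 1 < mu -> kpoly rho k mu = 0 ->
  exists r c : R, [/\ 0 <= r, r < 1, 0 < c & [/\ c * rho = k ^+ 2 - r ^+ 2,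
    c * (rho - 1) = (k ^+ 2 - 1) * r * mu &
    c * (rho - 2) = (k ^+ 2 * r ^+ 2 - 1) * mu ^+ 2]].
Proof.
move=> rho1 k1 mu1 q0.
have km : 0 < k * mu - 1 by nra.
(* [kpoly rho k mu] = (k mu - 1) (mu - k) + (rho - 1) k (mu^2 - 1), where the last term is
   nonnegative. *)
have muk : mu <= k.
  rewrite leNgt; apply/negP => h.
  have : 0 < (k * mu - 1) * (mu - k) by rewrite mulr_gt0// subr_gt0.
  have : 0 <= (rho - 1) * (k * (mu - 1) * (mu + 1)) by rewrite !mulr_ge0//; lra.
  by move: q0; rewrite /kpoly; nra.
(* Combining the three required equations with weights 1, -2, 1 eliminates c and rho. What remains
   factors as ((k + r) - (1 + k r) mu) ((k - r) + (1 - k r) mu) = 0, and the first factor gives this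
   r. *)
pose r := (k - mu) / (k * mu - 1).
have r0 : 0 <= r by apply: divr_ge0; [rewrite subr_ge0 | exact: ltW].
have r1 : r < 1 by rewrite ltr_pdivrMr//; nra.
have rE : mu * (1 + k * r) = k + r by rewrite /r; field; rewrite gt_eqF.
have m2 : k * (mu ^+ 2 - 1) != 0 by rewrite gt_eqF//; nra.
have rhoE : rho = ((k ^+ 2 + 1) * mu - 2 * k) / (k * (mu ^+ 2 - 1)).
  apply: (mulIf m2); rewrite divfK//; apply/eqP; rewrite -subr_eq0 -q0 /kpoly.
  by apply/eqP; ring.
exists r, (mu * k * (1 - r ^+ 2)); split=> //.
  by rewrite !mulr_gt0//; [lra | lra | rewrite subr_gt0 expr_lt1].
have k0 : k != 0 by rewrite gt_eqF//; lra.
have m20 : mu ^+ 2 - 1 != 0 by rewrite gt_eqF//; nra.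
have km0 : k * mu - 1 != 0 by rewrite gt_eqF.
by split; rewrite rhoE /r; field; rewrite ?k0 ?m20 ?km0.
Qed.

Lemma Ktilde_increasing rho K k : 1 <= rho -> 1 <= K -> K < k ->
  [/\ Ktilde K rho < Ktilde k rho, 1 < Ktilde k rho &
      kpoly rho k (Ktilde k rho) = 0].
Proof.
move=> rho1 K1 Kk; have k1 : 1 < k by exact: le_lt_trans K1 Kk.
have q0 := Ktilde_root rho1 (ltW k1).
have m1 := Ktilde_ge1 rho1 (ltW k1).
split=> //.
  rewrite Ktilde_lt//; set m := Ktilde k rho in q0 m1 *.
  have h : 0 < m * (k - K) * (K * k - 1) by apply: mulr_gt0; [apply: mulr_gt0; lra | nra].
  (* In k [kpoly rho K m] - K [kpoly rho k m] the terms with rho cancel, and the second polynomial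
     vanishes. *)
  have : k * kpoly rho K m = m * (k - K) * (K * k - 1).
    rewrite -[RHS]addr0 -(mulr0 K) -q0 /kpoly; ring.
  have k0 : 0 < k by lra.
  by move=> E; rewrite -(pmulr_rgt0 _ k0) E.
rewrite lt_neqAle m1 andbT; apply/eqP => m_eq1.
have : 0 < (k - 1) ^+ 2 by rewrite exprn_gt0// subr_gt0.
by move: q0; rewrite -m_eq1 /kpoly; nra.
Qed.

Let half_sum_root (s d : R) : d ^+ 2 = s ^+ 2 - 4 ->
  ((s + d) / 2) ^+ 2 + 1 = s * ((s + d) / 2).
Proof. by move=> e; have : d * d = s * s - 4 by []; nra. Qed.

(** Divided by k mu, the equation in k reads k + 1 / k = s with s = rho mu + (2 - rho) / mu, so k is
    the larger root of X^2 - s X + 1. *)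
Lemma Ktilde_inverse rho K mu : 1 <= rho -> 1 <= K -> Ktilde K rho < mu ->
  exists2 k, K < k & kpoly rho k mu = 0.
Proof.
move=> rho1 K1 Kmu; have mu1 : 1 < mu by exact: le_lt_trans (Ktilde_ge1 rho1 K1) Kmu.
move: Kmu; rewrite Ktilde_lt ?(ltW mu1)// => q0.
pose s := rho * mu + (2 - rho) / mu.
have mu0 : mu != 0 by rewrite gt_eqF//; lra.
have sK : K ^+ 2 + 1 < s * K.
  rewrite -(ltr_pM2r (_ : 0 < mu)); last lra.
  rewrite -subr_gt0 (_ : _ - _ = kpoly rho K mu)// /s /kpoly; by field.
have s2 : 2 * K < s * K by apply: le_lt_trans sK; have := sqr_ge0 (K - 1); nra.
have s2' : 2 < s by rewrite -(ltr_pM2r (_ : 0 < K))//; lra.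
have d0 : 0 <= s ^+ 2 - 4 by nra.
pose k := (s + Num.sqrt (s ^+ 2 - 4)) / 2.
have kE : k ^+ 2 + 1 = s * k.
  have e : Num.sqrt (s ^+ 2 - 4) ^+ 2 = s ^+ 2 - 4 by rewrite sqr_sqrtr.
  exact: half_sum_root.
exists k; last first.
  have -> : kpoly rho k mu = mu * (s * k - (k ^+ 2 + 1)) by rewrite /s /kpoly; field.
  by rewrite kE subrr mulr0.
(* [sK] places K strictly between the roots 1 / k and k. *)
have [//|kK] := ltrP K k; exfalso.
have k1 : 1 < k by rewrite /k ltr_pdivlMr//; have := sqrtr_ge0 (s ^+ 2 - 4); lra.
have : (K - k) * (K * k - 1) < 0.
  have -> : (K - k) * (K * k - 1) = k * (K ^+ 2 + 1 - s * K) + K * (s * k - (k ^+ 2 + 1)) by ring.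
  by rewrite kE subrr mulr0 addr0 pmulr_rlt0 ?subr_lt0//; lra.
by apply/negP; rewrite -leNgt mulr_ge0 ?subr_ge0//; nra.
Qed.

End KtildeAlgebra.

(** * Families stable under Moebius maps *)

Lemma csqN (R : realType) (z : R[i]) : csq (- z) = csq z.
Proof. by case: z => a b; rewrite /csq /= !sqrrN. Qed.

Section OpNorm.
Variables (R : realType) (H : hilbertType R).
Let rP := rdot_form H.

Lemma op_norm_le (S : H -> H) (K : R) : linear S -> 0 <= K ->
  (op_norm S <= K%:E)%E <-> forall x, nsq (S x) <= K ^+ 2 * nsq x.
Proof.
move=> Sl K0; split=> [SK x|SK].
  have [x0|x0] := eqVneq (nsq x) 0.
    have -> : x = 0 by apply/eqP; rewrite -nsq_eq0 x0.
    by rewrite (lin0 Sl) (rf0l rP) mulr0.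
  have n0 : 0 < nsq x by rewrite lt_neqAle eq_sym x0 (rf_ge0 rP).
  pose a : R := (Num.sqrt (nsq x))^-1.
  have a2 : a ^+ 2 = (nsq x)^-1 by rewrite exprVn sqr_sqrtr// ltW.
  have : nsq (S (a%:C *: x)) <= K ^+ 2.
    have : ((complex.Re `|S (a%:C *: x)|)%:E <= K%:E)%E.
      apply: le_trans SK; apply: ereal_sup_ubound; exists (a%:C *: x) => //=.
      rewrite (norm_le_nsq _ ler01) (rf_scale2 rP) csqR a2 mulVf// expr1n.
      exact: lexx.
    rewrite lee_fin nsq_norm => h; rewrite ler_sqr// nnegrE.
    by rewrite norm_nsq sqrtr_ge0.
  rewrite (linZ Sl) (rf_scale2 rP) csqR a2 => h.
  by rewrite -ler_pdivrMr// mulrC.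
apply: ge_ereal_sup => _ [x /= x1 <-]; rewrite lee_fin norm_nsq /=.
rewrite -[K](ger0_norm K0) -sqrtr_sqr ler_wsqrtr//; apply: le_trans (SK x) _.
rewrite -[leRHS]mulr1 ler_wpM2l ?sqr_ge0//.
by move: x1; rewrite (norm_le_nsq _ ler01) expr1n.
Qed.

End OpNorm.

(** [mc_moebius] says G = (a + S) (1 + a^* S)^-1 with the inverse multiplied out. [mc_iter] turns a
    uniform norm bound on B into power boundedness of its members. *)
Record moebius_class (R : realType) (H : hilbertType R) (B : set (H -> H)) : Prop :=
  MoebiusClass {
  mc_linear : forall S, B S -> linear S ;
  mc_iter : forall S n, B S -> B (iter n S) ;
  mc_moebius : forall S (a : R[i]), B S -> csq a < 1 ->
    exists2 G, B G & forall x, G (x + Num.conj a *: S x) = a *: x + S x }.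

Section MoebiusClass.
Variables (R : realType) (H : hilbertType R) (B : set (H -> H)) (K rho : R).
Hypotheses (K_ge1 : 1 <= K) (rho_ge1 : 1 <= rho) (BP : moebius_class B).
Let rP := rdot_form H.

Let K_ge0 : 0 <= K. Proof. exact: le_trans ler01 K_ge1. Qed.

Let moebius_qform (k r mu c : R) (z : R[i]) (x y : H) : 0 < mu -> csq z = 1 ->
  c * rho = k ^+ 2 - r ^+ 2 -> c * (rho - 1) = (k ^+ 2 - 1) * r * mu ->
  c * (rho - 2) = (k ^+ 2 * r ^+ 2 - 1) * mu ^+ 2 ->
  c * qform rho (z *: (mu^-1%:C *: y)) x =
    k ^+ 2 * nsq (x - (r%:C * z) *: y) - nsq (y - (r%:C * Num.conj z) *: x).
Proof.
move=> mu0 z1 c1 c2 c3.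
have -> : z *: (mu^-1%:C *: y) = mu^-1%:C *: (z *: y) by rewrite !scalerA mulrC.
rewrite /qform (rfZl rP) (rf_scale2 rP _ (z *: y)) csqR (rf_scale2 rP z) z1.
rewrite -!scalerA !(rf_sqB rP) !(rfZr rP) !(rfZl rP) (rfC rP x) -(rf_conj rP z y x).
rewrite !(rf_scale2 rP) csq_conj z1.
move: (nsq x) (nsq y) (rdot (z *: y) x) => p q s.
transitivity ((c * rho) * p - 2 * (c * (rho - 1)) * (mu^-1 * s)
  + (c * (rho - 2)) * (mu^-1 ^+ 2 * q)); first by ring.
by rewrite c1 c2 c3; field; rewrite gt_eqF.
Qed.

Lemma norm_radius :
  (forall S, B S -> (op_norm S <= K%:E)%E) ->
  forall S, B S -> (op_radius rho S <= (Ktilde K rho)%:E)%E.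
Proof.
move=> SK S BS; have Sl := mc_linear BP BS.
have SKn T x : B T -> nsq (T x) <= K ^+ 2 * nsq x.
  by move=> BT; move: x; apply/(op_norm_le (mc_linear BP BT) K_ge0); exact: SK.
suff radius_le mu : Ktilde K rho < mu -> (op_radius rho S <= mu%:E)%E.
  apply/lee_addgt0Pr => e e0; rewrite -EFinD; apply: radius_le.
  by rewrite ltrDl.
move=> Kmu; have mu1 : 1 < mu by exact: le_lt_trans (Ktilde_ge1 rho_ge1 K_ge1) Kmu.
have mu0 : 0 < mu by exact: lt_trans ltr01 mu1.
have [k Kk q0] := Ktilde_inverse rho_ge1 K_ge1 Kmu.
have k1 : 1 < k by exact: le_lt_trans K_ge1 Kk.
have [r [c [r0 r1 c0 [c1 c2 c3]]]] := kpoly_param rho_ge1 k1 mu1 q0.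
apply: ereal_inf_lbound; exists mu => //; split => //.
(* With y = x - r z S x and G the Moebius transform, (1 - r^2) x = y - a^* G y, so (1 - r^2)^2 |x|^2
   <= d |y|^2. Then c times [qform] is k^2 |y|^2 - |G y|^2 >= (k^2 - K^2) |y|^2, which yields
   [eps]. *)
pose d : R := 2 + 2 * (r ^+ 2 * K ^+ 2).
have d0 : 0 < d by rewrite /d ltr_pwDl// !mulr_ge0 ?sqr_ge0.
have r2 : r ^+ 2 < 1 by rewrite expr_lt1.
pose eps : R := (k ^+ 2 - K ^+ 2) * ((1 - r ^+ 2) ^+ 2 / d) / c.
have kK : 0 < k ^+ 2 - K ^+ 2 by rewrite subr_gt0 ltr_sqr ?nnegrE//; lra.
have eps0 : 0 < eps.
  by rewrite /eps divr_gt0// mulr_gt0// divr_gt0// exprn_gt0// subr_gt0.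
have S'l : linear (fun x => mu^-1%:C *: S x).
  by move=> a x y; rewrite Sl scalerDr !scalerA (mulrC a).
have S'n n x : iter n (fun x => mu^-1%:C *: S x) x = (mu^-1 ^+ n)%:C *: iter n S x.
  elim: n => [|n IH]; first by rewrite expr0 scale1r.
  by rewrite !iterS IH (linZ Sl) scalerA -rmorphM -exprS.
(* Powers of S stay in B, so |S^n x| <= K |x| and the powers of S / mu decay like mu^-n: the orbits
   are square summable. *)
apply: (@dilation _ _ _ rho eps (K ^+ 2) (mu^-1 ^+ 2)) => //.
- by rewrite sqr_ge0.
- by rewrite expr_lt1 ?invr_ge0 ?(ltW mu0)// invf_lt1.
- move=> n x; rewrite S'n (rf_scale2 rP) csqR -!exprM mulnC -mulrA mulrCA.
  rewrite ler_wpM2l ?exprn_ge0 ?invr_ge0 ?(ltW mu0)//.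
  by apply: SKn; exact: (mc_iter BP).
move=> z x z1.
pose a := - (r%:C * Num.conj z).
have ar : csq a = r ^+ 2.
  by rewrite /a csqN csqM csqR csq_conj z1 mulr1.
have a1 : csq a < 1 by rewrite ar.
have ca : Num.conj a = - (r%:C * z).
  rewrite /a rmorphN rmorphM /= conjCK; congr (- (_ * _)); exact: conjc_real.
have [G BG GE] := mc_moebius BP BS a1.
set y := x - (r%:C * z) *: S x.
have yE : x + Num.conj a *: S x = y by rewrite ca scaleNr.
have Gy : G y = S x - (r%:C * Num.conj z) *: x by rewrite -yE GE /a scaleNr addrC.
have xy : (1 - r ^+ 2) ^+ 2 * nsq x <= d * nsq y.
  have xE : (1 - r ^+ 2)%:C *: x = y - Num.conj a *: G y.
    rewrite Gy ca scaleNr opprK scalerBr addrA /y subrK scalerA.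
    rewrite rmorphB rmorph1 scalerBl scale1r; congr (_ - _ *: _).
    by rewrite mulrACA -normCK -csq_normE z1 mulr1 -rmorphM.
  rewrite -(csqR (1 - r ^+ 2)) -(rf_scale2 rP) xE.
  have h1 := SKn _ y BG; have h2 := rf_sqB_le rP y (Num.conj a *: G y).
  apply: (le_trans h2); rewrite (rf_scale2 rP) csq_conj ar.
  have -> : d * nsq y = 2 * nsq y + 2 * (r ^+ 2 * (K ^+ 2 * nsq y)) by rewrite /d; ring.
  by rewrite lerD2l ler_wpM2l// ler_wpM2l ?sqr_ge0.
rewrite -(ler_pM2l c0) (moebius_qform _ _ mu0 z1 c1 c2 c3) -/y -Gy.
rewrite /eps mulrA [c * _]mulrC divfK ?gt_eqF// -mulrA.
have := SKn _ y BG.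
have : (k ^+ 2 - K ^+ 2) * ((1 - r ^+ 2) ^+ 2 / d * nsq x) <= (k ^+ 2 - K ^+ 2) * nsq y.
  by rewrite ler_wpM2l ?(ltW kK)// mulrAC ler_pdivrMr// [leRHS]mulrC.
lra.
Qed.

(** The Moebius transform S of G with parameter r is inverted by the one with parameter -r: at y = x
    + r G x, y - r S y = (1 - r^2) x and S y - r y = (1 - r^2) G x. Positivity of [qform] at y thus
    reads |G x| <= k |x|. *)
Lemma radius_norm :
  (forall S, B S -> (op_radius rho S <= (Ktilde K rho)%:E)%E) ->
  forall S, B S -> (op_norm S <= K%:E)%E.
Proof.
move=> SK G BG; have Gl := mc_linear BP BG.
apply/(op_norm_le Gl K_ge0) => x.
suff G_le k : K < k -> nsq (G x) <= k ^+ 2 * nsq x.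
  rewrite -subr_le0; apply: (@real_eps0 _ _ (nsq x)) => e e0.
  have := G_le (Num.sqrt (K ^+ 2 + e)); rewrite sqr_sqrtr; last first.
    by rewrite addr_ge0 ?sqr_ge0// ltW.
  have -> : K < Num.sqrt (K ^+ 2 + e).
    rewrite -[ltLHS](ger0_norm K_ge0) -sqrtr_sqr ltr_sqrt ?ltrDl//.
    by rewrite ltr_wpDl ?sqr_ge0.
  by move=> /(_ isT); lra.
move=> Kk; have k1 : 1 < k by exact: le_lt_trans K_ge1 Kk.
have [Kmu mu1 q0] := Ktilde_increasing rho_ge1 K_ge1 Kk.
have [r [c [r0 r1 c0 [c1 c2 c3]]]] := kpoly_param rho_ge1 k1 mu1 q0.
set mu := Ktilde k rho in Kmu mu1 c2 c3.
have mu0 : 0 < mu by exact: lt_trans ltr01 mu1.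
have r2 : r ^+ 2 < 1 by rewrite expr_lt1.
have [|S BS SE] := mc_moebius BP BG (a := r%:C); first by rewrite csqR.
have [l [l0 lC] lmu] : exists2 l, 0 < l /\ class_C rho (fun x => (l^-1)%:C *: S x) & l < mu.
  have Smu : (op_radius rho S < mu%:E)%E by apply: le_lt_trans (SK _ BS) _; rewrite lte_fin.
  have [_ [l [l0 lC] <-] lmu] := ereal_inf_lt Smu.
  by exists l.
pose y := x + r%:C *: G x.
have yE : x + Num.conj r%:C *: G x = y.
  by rewrite (_ : Num.conj r%:C = r%:C)//; exact: conjc_real.
have Sy : S y = r%:C *: x + G x by rewrite -yE SE.
(* The factor l / mu lies in the open disc and turns S / l into S / mu. *)
have lm1 : csq (l / mu)%:C < 1.
  have lm0 : 0 <= l / mu by apply: divr_ge0; exact: ltW.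
  by rewrite csqR expr_lt1// ltr_pdivrMr// mul1r.
have := class_C_qform y rho_ge1 lC lm1.
rewrite scalerA -rmorphM mulrAC divff ?gt_eqF// mul1r => h.
have := mulr_ge0 (ltW c0) h.
rewrite -[mu^-1%:C *: _]scale1r (moebius_qform _ _ mu0 (csq1 R) c1 c2 c3) Sy rmorph1 !mulr1.
rewrite (_ : y - _ = (1 - r ^+ 2)%:C *: x); last first.
  rewrite /y scalerDr opprD addrACA subrr addr0 scalerA -rmorphM.
  by rewrite rmorphB rmorph1 scalerBl scale1r.
rewrite (_ : r%:C *: x + _ - _ = (1 - r ^+ 2)%:C *: G x); last first.
  rewrite /y scalerDr opprD addrACA subrr add0r scalerA -rmorphM.
  by rewrite rmorphB rmorph1 scalerBl scale1r.
rewrite !(rf_scale2 rP) !csqR mulrCA -mulrBr pmulr_rge0 ?subr_ge0//.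
by rewrite exprn_gt0// subr_gt0.
Qed.

End MoebiusClass.

(** * Polynomial calculus *)

Section PolyOp.
Variables (R : realType) (H : hilbertType R) (T : H -> H).
Hypothesis T_lin : linear T.
Implicit Types (p q : {poly R[i]}) (x y : H).

Lemma poly_op_widen n p x : (size p <= n)%N ->
  poly_op p T x = \sum_(k < n) p`_k *: iter k T x.
Proof.
move=> pn; rewrite -(subnKC pn) big_split_ord /= [X in _ + X]big1 ?addr0// => k _.
by rewrite nth_default ?scale0r// leq_addr.
Qed.

Lemma poly_op_lin p : linear (poly_op p T).
Proof.
move=> a x y; rewrite /poly_op scaler_sumr -big_split; apply: eq_bigr => k _ /=.
by rewrite (lin_iter k T_lin) scalerDr !scalerA mulrC.
Qed.

Lemma poly_opD p q x : poly_op (p + q) T x = poly_op p T x + poly_op q T x.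
Proof.
have [pn qn] := (leq_maxl (size p) (size q), leq_maxr (size p) (size q)).
rewrite (poly_op_widen _ pn) (poly_op_widen _ qn).
rewrite (poly_op_widen _ (size_polyD p q)) -big_split; apply: eq_bigr => k _.
by rewrite coefD scalerDl.
Qed.

Lemma poly_opC c x : poly_op c%:P T x = c *: x.
Proof. by rewrite (poly_op_widen _ (size_polyC_leq1 c)) big_ord1 coefC. Qed.

Lemma poly_op_comm p x : poly_op p T (T x) = T (poly_op p T x).
Proof.
rewrite /poly_op (lin_sum T_lin); apply: eq_bigr => k _.
by rewrite (linZ T_lin) -iterSr.
Qed.

Lemma poly_opMX p x : poly_op (p * 'X) T x = poly_op p T (T x).
Proof.
have [->|p0] := eqVneq p 0.
  by rewrite mul0r /poly_op size_poly0 !big_ord0.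
rewrite (poly_op_widen _ (leqnn _)) size_mulX// big_ord_recl coefMX /= scale0r add0r.
by apply: eq_bigr => k _; rewrite coefMX /= -iterSr.
Qed.

Lemma poly_opZ c p x : poly_op (c *: p) T x = c *: poly_op p T x.
Proof.
rewrite (poly_op_widen _ (size_scale_leq c p)) scaler_sumr; apply: eq_bigr => k _.
by rewrite coefZ scalerA.
Qed.

Lemma poly_opM p q x : poly_op (p * q) T x = poly_op p T (poly_op q T x).
Proof.
elim/poly_ind: p x => [|p c IH] x.
  by rewrite mul0r /poly_op size_poly0 !big_ord0.
rewrite mulrDl -mulrA (mulrC 'X) mulrA mul_polyC !poly_opD poly_opC poly_opZ.
by rewrite !poly_opMX IH poly_op_comm.
Qed.

Lemma poly_op_XsubC c x : poly_op ('X - c%:P) T x = T x - c *: x.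
Proof.
rewrite -polyCN poly_opD poly_opC scaleNr -['X]mul1r poly_opMX.
by rewrite poly_opC scale1r.
Qed.

Lemma poly_op_prod_bij (s : seq R[i]) :
  (forall c, c \in s -> ~ spectrum T c) ->
  bijective (poly_op (\prod_(c <- s) ('X - c%:P)) T).
Proof.
elim: s => [|c s IH] hs.
  by exists id => x; rewrite big_nil poly_opC scale1r.
have /IH IHs : forall d, d \in s -> ~ spectrum T d.
  by move=> d ds; apply: hs; rewrite in_cons ds orbT.
have /contrapT[B [_ BK KB]] := hs c (mem_head c s).
have bc : bijective (fun x => T x - c *: x) by exists B.
apply: (eq_bij (bij_comp bc IHs)) => x.
by rewrite big_cons poly_opM poly_op_XsubC.
Qed.

Lemma poly_op_bij p : p != 0 -> (forall c, spectrum T c -> p.[c] != 0) ->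
  bijective (poly_op p T).
Proof.
move=> p0 pT; have [s ps] := closed_field_poly_normal p.
have l0 : lead_coef p != 0 by rewrite lead_coef_eq0.
have bs : bijective (poly_op (\prod_(c <- s) ('X - c%:P)) T).
  apply: poly_op_prod_bij => c cs cT; have /negP := pT c cT; apply.
  by rewrite ps hornerZ mulf_eq0 -/(root _ _) root_prod_XsubC cs orbT.
have bl : bijective (fun x : H => lead_coef p *: x).
  by exists (fun x => (lead_coef p)^-1 *: x) => x; rewrite scalerA ?mulVf ?mulfV// scale1r.
by apply: (eq_bij (bij_comp bl bs)) => x; rewrite [in RHS]ps poly_opZ.
Qed.

Lemma op_invK (A : H -> H) : bijective A -> cancel A (op_inv A) /\ cancel (op_inv A) A.
Proof.
move=> bA; have iA := bij_inj bA; case: bA => B BK KB.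
have h y : A (op_inv A y) = y.
  by apply: (@getPex _ [set x | A x = y]); exists (B y); exact: KB.
by split=> // x; apply: iA; rewrite h.
Qed.

(** This makes f(T) independent of the fraction chosen for f, so a matrix can be put over one
    denominator. *)
Lemma rat_op_repr (S : set R[i]^o) (f : ratfun S) (P D : {poly R[i]}) x :
  bijective (poly_op (ratden f) T) -> bijective (poly_op D T) ->
  ratnum f * D = P * ratden f -> rat_op f T (poly_op D T x) = poly_op P T x.
Proof.
move=> bq bD e; apply: (bij_inj bD).
rewrite /rat_op /= -poly_opM mulrC e poly_opM (op_invK bq).2.
by rewrite -!poly_opM mulrC.
Qed.

Definition pmx_op n (P : 'M[{poly R[i]}]_n) (x : l2sum n H) : l2sum n H :=
  [ffun i => \sum_j poly_op (P i j) T (x j)].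

Lemma pmx_op_lin n (P : 'M[{poly R[i]}]_n) : linear (pmx_op P).
Proof.
move=> a x y; apply/ffunP => i; rewrite !ffunE scaler_sumr -big_split.
by apply: eq_bigr => j _; rewrite !ffunE poly_op_lin.
Qed.

Lemma pmx_opD n (P Q : 'M[{poly R[i]}]_n) (x : l2sum n H) : pmx_op (P + Q) x = pmx_op P x + pmx_op Q x.
Proof.
apply/ffunP => i; rewrite !ffunE -big_split.
by apply: eq_bigr => j _; rewrite mxE poly_opD.
Qed.

Lemma poly_op_sum (I : finType) (F : I -> {poly R[i]}) x :
  poly_op (\sum_i F i) T x = \sum_i poly_op (F i) T x.
Proof.
apply: (big_morph (fun p => poly_op p T x)) => [p q|]; first exact: poly_opD.
by rewrite /poly_op size_poly0 big_ord0.
Qed.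

Lemma pmx_opM n (P Q : 'M[{poly R[i]}]_n) (x : l2sum n H) : pmx_op (P *m Q) x = pmx_op P (pmx_op Q x).
Proof.
apply/ffunP => i; rewrite !ffunE.
under eq_bigr => j _ do rewrite mxE poly_op_sum.
rewrite exchange_big; apply: eq_bigr => j _; rewrite ffunE (lin_sum (poly_op_lin _)).
by apply: eq_bigr => k _; rewrite poly_opM.
Qed.

Lemma pmx_op_scalar n D (x : l2sum n H) i : pmx_op D%:M x i = poly_op D T (x i).
Proof.
rewrite ffunE (bigD1 i)//= mxE eqxx mulr1n big1 ?addr0// => j /negPf ji.
by rewrite mxE eq_sym ji mulr0n /poly_op size_poly0 big_ord0.
Qed.

Lemma pmx_opZ n c (P : 'M[{poly R[i]}]_n) (x : l2sum n H) : pmx_op (c%:P *: P) x = c *: pmx_op P x.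
Proof.
apply/ffunP => i; rewrite !ffunE scaler_sumr; apply: eq_bigr => j _.
by rewrite mxE mul_polyC poly_opZ.
Qed.

Lemma pmx_op_scalar_bij n D : bijective (poly_op D T) ->
  bijective (pmx_op (D%:M : 'M[{poly R[i]}]_n)).
Proof.
case=> B BK KB; exists (fun x : l2sum n H => [ffun i => B (x i)] : l2sum n H) => x.
  by apply/ffunP => i; rewrite ffunE pmx_op_scalar BK.
by apply/ffunP => i; rewrite pmx_op_scalar ffunE KB.
Qed.

End PolyOp.

(** * Column vectors and continuity *)

Section ColumnVectors.
Variables (R : realType) (n : nat).
Implicit Types (u v : 'cV[R[i]]_n).

Definition cvdot u v : R := \sum_i complex.Re (u i 0 * Num.conj (v i 0)).
Local Notation vsq v := (cvdot v v).

Lemma Re_mulJ (z : R[i]) : Re (z * Num.conj z) = csq z.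
Proof. by case: z => a b; rewrite /csq /=; ring. Qed.

Lemma cvdotE v : vsq v = \sum_i csq (v i 0).
Proof. by apply: eq_bigr => i _; rewrite Re_mulJ. Qed.

Lemma cvdot_form : real_form cvdot.
Proof.
split.
- by move=> x y z; rewrite /cvdot -big_split; apply: eq_bigr => i _; rewrite mxE mulrDl cReD.
- by move=> a x y; rewrite /cvdot mulr_sumr; apply: eq_bigr => i _; rewrite mxE -mulrA cReZ.
- move=> x y; apply: eq_bigr => i _; rewrite !cReM !cRe_conj !cIm_conj; ring.
- move=> x y; apply: eq_bigr => i _; rewrite !mxE !cReM !cRe_conj !cIm_conj !cReM.
  by case: (x i 0) (y i 0) => a b [c d] /=; ring.
- by move=> x; rewrite cvdotE sumr_ge0// => i _; exact: csq_ge0.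
Qed.

Lemma vsq_eq0 v : vsq v = 0 -> v = 0.
Proof.
rewrite cvdotE => /eqP; rewrite psumr_eq0 => [/allP h|i _]; last exact: csq_ge0.
apply/matrixP => i j; rewrite (ord1 j) mxE; apply/eqP.
by rewrite -csq_eq0; apply: (h i); rewrite mem_index_enum.
Qed.

Lemma l2norm_vsq v : l2norm v = Num.sqrt (vsq v).
Proof. by rewrite cvdotE; congr Num.sqrt; apply: eq_bigr => i _; rewrite csq_Re_norm. Qed.

Lemma mx_norm2_le (A : 'M[R[i]]_n) (N : R) : 0 <= N ->
  (mx_norm2 A <= N%:E)%E <-> forall v, vsq (A *m v) <= N ^+ 2 * vsq v.
Proof.
move=> N0; have vP := cvdot_form; split=> [AN v|AN].
  have [v0|v0] := eqVneq (vsq v) 0.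
    by rewrite (vsq_eq0 v0) mulmx0 (rf0l vP) mulr0.
  have n0 : 0 < vsq v by rewrite lt_neqAle eq_sym v0 (rf_ge0 vP).
  pose a : R := (Num.sqrt (vsq v))^-1.
  have a2 : a ^+ 2 = (vsq v)^-1 by rewrite exprVn sqr_sqrtr// ltW.
  have : vsq (A *m (a%:C *: v)) <= N ^+ 2.
    have : ((l2norm (A *m (a%:C *: v)))%:E <= N%:E)%E.
      apply: le_trans AN; apply: ereal_sup_ubound; exists (a%:C *: v) => //=.
      by rewrite l2norm_vsq (rf_scale2 vP) csqR a2 mulVf// sqrtr1.
    rewrite lee_fin l2norm_vsq => h.
    rewrite -[leLHS]sqr_sqrtr ?(rf_ge0 vP)//.
    by rewrite ler_sqr// nnegrE sqrtr_ge0.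
  rewrite -scalemxAr (rf_scale2 vP) csqR a2 => h.
  by rewrite -ler_pdivrMr// mulrC.
apply: ge_ereal_sup => _ [v /= v1 <-]; rewrite lee_fin l2norm_vsq.
rewrite -[N](ger0_norm N0) -sqrtr_sqr ler_wsqrtr//; apply: le_trans (AN v) _.
rewrite -[leRHS]mulr1 ler_wpM2l ?sqr_ge0//.
move: v1; rewrite l2norm_vsq => v1.
by rewrite -(sqr_sqrtr (rf_ge0 vP v)) expr_le1// sqrtr_ge0.
Qed.

End ColumnVectors.
Notation vsq v := (cvdot v v).

Section ComplexContinuity.
Variable R : realType.

Lemma continuous_Re : continuous (fun z : R[i]^o => complex.Re z : R).
Proof.
move=> z; have FF : Filter (nbhs (z : R[i]^o)) by exact: nbhs_filter.
apply/cvgrPdist_lt => e e0.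
have e1 : 0 < e%:C :> R[i] by rewrite ltcR.
have := @nbhsx_ballx _ (R[i]^o) z e%:C e1; apply: filterS => w.
rewrite -ball_normE /= => zw.
rewrite -ltcR; apply: le_lt_trans zw.
by have := normc_ge_Re (z - w); case: (z) (w) => a b [c d].
Qed.

Lemma continuous_Im : continuous (fun z : R[i]^o => complex.Im z : R).
Proof.
move=> z; have FF : Filter (nbhs (z : R[i]^o)) by exact: nbhs_filter.
apply/cvgrPdist_lt => e e0.
have e1 : 0 < e%:C :> R[i] by rewrite ltcR.
have := @nbhsx_ballx _ (R[i]^o) z e%:C e1; apply: filterS => w.
rewrite -ball_normE /= => zw.
rewrite -ltcR; apply: le_lt_trans zw.
have := normc_ge_Re ((z - w) * 'i); rewrite normrM.
rewrite (_ : `|'i| = 1 :> R[i]) ?mulr1; last first.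
  by rewrite complexiE normCi.
rewrite ReiNIm normrN.
by case: (z) (w) => a b [c d].
Qed.

Lemma continuous_horner_parts (p : {poly R[i]}) :
  continuous (fun z : R[i]^o => complex.Re p.[z] : R) /\
  continuous (fun z : R[i]^o => complex.Im p.[z] : R).
Proof.
elim/poly_ind: p => [|p c [cr ci]].
  split; rewrite (_ : (fun=> _) = fun=> 0); try exact: cst_continuous;
    by apply/funext => z; rewrite horner0.
split.
  rewrite (_ : (fun=> _) = fun z : R[i]^o =>
    Re p.[z] * Re z - Im p.[z] * Im z + Re c); last first.
    by apply/funext => z; rewrite hornerMXaddC cReD cReM.
  move=> z; exact: (cvgD (cvgB (cvgM (cr z) (@continuous_Re z))
    (cvgM (ci z) (@continuous_Im z))) (cvg_cst (Re c))).
rewrite (_ : (fun=> _) = fun z : R[i]^o =>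
  Re p.[z] * Im z + Im p.[z] * Re z + Im c); last first.
  by apply/funext => z; rewrite hornerMXaddC cImD cImM.
move=> z; exact: (cvgD (cvgD (cvgM (cr z) (@continuous_Im z))
  (cvgM (ci z) (@continuous_Re z))) (cvg_cst (Im c))).
Qed.

Lemma continuous_csq_horner (p : {poly R[i]}) :
  continuous (fun z : R[i]^o => csq p.[z]).
Proof.
have [cr ci] := continuous_horner_parts p.
by move=> z; exact: (cvgD (cvgM (cr z) (cr z)) (cvgM (ci z) (ci z))).
Qed.

End ComplexContinuity.

(** * Rational calculus *)

Section RationalCalculus.
Variables (R : realType) (H : hilbertType R) (T : H -> H) (Omega : set R[i]^o).
Hypotheses (T_lin : linear T) (T_spectrum : spectrum T `<=` closure Omega).
Hypothesis Omega0 : Omega !=set0.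
Local Notation clO := (closure Omega).
Local Notation MP n := 'M[{poly R[i]}]_n.
Implicit Types (D : {poly R[i]}).

Definition pole_free D := forall z : R[i], clO z -> D.[z] != 0.

Lemma pole_free_neq0 D : pole_free D -> D != 0.
Proof.
move=> hD; have [z Oz] := Omega0; apply/eqP => D0.
by have := hD z (subset_closure Oz); rewrite D0 horner0 eqxx.
Qed.

Lemma pole_free_bij D : pole_free D -> bijective (poly_op D T).
Proof.
move=> hD; apply: (poly_op_bij T_lin (pole_free_neq0 hD)) => c cT.
by apply: hD; exact: T_spectrum.
Qed.

Lemma pole_freeM D E : pole_free D -> pole_free E -> pole_free (D * E).
Proof. by move=> hD hE z Oz; rewrite hornerM mulf_neq0 ?hD ?hE. Qed.

Lemma pole_free_den (f : ratfun clO) : pole_free (ratden f).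
Proof. exact: ratden_off. Qed.

Lemma rat_norm_ge0 (f : ratfun clO) : (0 <= rat_norm Omega f)%E.
Proof.
have [z Oz] := Omega0; apply: le_trans (ereal_sup_ubound _); last by exists z.
by rewrite lee_fin; have := normr_ge0 (rat_eval f z); rewrite lecE => /andP[].
Qed.

Section Matrices.
Variable n : nat.
Implicit Types (P Q : MP n) (F : 'M[ratfun clO]_n).

Definition evalmx (z : R[i]) P : 'M[R[i]]_n := map_mx (horner_eval z) P.

Lemma evalmxM z P Q : evalmx z (P *m Q) = evalmx z P *m evalmx z Q.
Proof. exact: map_mxM. Qed.

(** The bound |P(z) / D(z)| <= 1 with the denominator cleared: a polynomial inequality, which passes
    to the closure by continuity. *)
Definition contractive P D := forall z : R[i], Omega z -> forall v : 'cV[R[i]]_n,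
  vsq (evalmx z P *m v) <= csq D.[z] * vsq v.

(* S = F(T) for the rational matrix F = P / D, stated without inverting D(T). *)
Definition represents P D (S : l2sum n H -> l2sum n H) :=
  forall x, S (pmx_op T D%:M x) = pmx_op T P x.

Lemma evalmx_col P z (v : 'cV[R[i]]_n) i :
  (evalmx z P *m v) i 0 = (\sum_j P i j * (v j 0)%:P).[z].
Proof.
rewrite mxE horner_sum; apply: eq_bigr => j _.
by rewrite mxE hornerM hornerC.
Qed.

(** The norm is a supremum over Omega, whereas poles have to be excluded on its closure; this
    bridges the two for the denominator of a Moebius transform. *)
Lemma contractive_closure P D : contractive P D -> forall z : R[i], clO z ->
  forall v : 'cV[R[i]]_n, vsq (evalmx z P *m v) <= csq D.[z] * vsq v.
Proof.
move=> PD z Oz v.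
pose g (w : R[i]^o) : R := csq D.[w] * vsq v -
  \sum_i csq (\sum_j P i j * (v j 0)%:P).[w].
have gE w : csq D.[w] * vsq v - vsq (evalmx w P *m v) = g w.
  rewrite /g [X in _ - X]cvdotE; congr (_ - _); apply: eq_bigr => i _.
  by rewrite evalmx_col.
have gc : continuous g.
  have sc (s : seq 'I_n) : continuous (fun w : R[i]^o =>
      \sum_(i <- s) csq (\sum_j P i j * (v j 0)%:P).[w]).
    elim: s => [|i s IH] w.
      by under eq_fun do rewrite big_nil; exact: (@cst_continuous _ _ _ w).
    under eq_fun do rewrite big_cons.
    exact: (cvgD (@continuous_csq_horner _ _ w) (IH w)).
  move=> w.
  exact: (cvgB (cvgM (@continuous_csq_horner _ D w) (cvg_cst (vsq v))) (sc _ w)).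
rewrite -subr_ge0 gE.
have gcl : closed [set w : R[i]^o | 0 <= g w].
  by apply: (@closed_comp _ _ g [set x : R | 0 <= x]) => [w _|]; [exact: gc | exact: closed_ge].
rewrite closure_id in gcl.
have : clO `<=` [set w : R[i]^o | 0 <= g w].
  rewrite gcl; apply: closureS => w Ow /=; rewrite -gE subr_ge0; exact: PD.
exact.
Qed.

Lemma represents_unique P D S S' : pole_free D ->
  represents P D S -> represents P D S' -> S = S'.
Proof.
move=> /pole_free_bij/(pmx_op_scalar_bij n)[B _ KB] SP S'P.
by apply/funext => x; rewrite -(KB x) SP S'P.
Qed.

Lemma rational_represents F P D : pole_free D ->
  (forall i j, ratnum (F i j) * D = P i j * ratden (F i j)) ->
  represents P D (ratmx_op F T).
Proof.
move=> hD FP x; apply/ffunP => i; rewrite !ffunE; apply: eq_bigr => j _.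
rewrite pmx_op_scalar; apply: rat_op_repr => //; apply: pole_free_bij => //.
exact: pole_free_den.
Qed.

Lemma rational_contractive F P D : pole_free D ->
  (forall i j, ratnum (F i j) * D = P i j * ratden (F i j)) ->
  contractive P D <-> (ratmx_norm Omega F <= 1%:E)%E.
Proof.
move=> hD FP.
have FE (z : R[i]) : Omega z ->
    evalmx z P = D.[z] *: map_mx (fun f => rat_eval f z) F.
  move=> Oz; apply/matrixP => i j; rewrite !mxE /rat_eval.
  have d0 := @pole_free_den (F i j) z (subset_closure Oz).
  have D0 := hD z (subset_closure Oz).
  rewrite mulrA mulrC [D.[z] * _]mulrC -hornerM FP hornerM.
  by rewrite mulrCA mulVf ?mulr1.
split=> [PD|F1 z Oz v].
  apply: ge_ereal_sup => _ [z Oz <-]; apply/(mx_norm2_le _ ler01) => v.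
  have D0 := hD _ (subset_closure Oz); have := PD z Oz v.
  rewrite FE// -scalemxAl (rf_scale2 (cvdot_form _ _)) expr1n mul1r ler_pM2l//.
  by rewrite lt_neqAle csq_ge0 eq_sym csq_eq0 D0.
rewrite FE// -scalemxAl (rf_scale2 (cvdot_form _ _)) ler_wpM2l ?csq_ge0//.
rewrite -[leRHS]mul1r -(expr1n _ 2); move: v; apply/(mx_norm2_le _ ler01).
by apply: le_trans F1; apply: ereal_sup_ubound; exists z.
Qed.

Definition contraction_family : set (l2sum n H -> l2sum n H) :=
  [set ratmx_op F T | F in [set F : 'M[ratfun clO]_n | (ratmx_norm Omega F <= 1%:E)%E]].

Lemma common_denominator F : exists P D, pole_free D /\
  forall i j, ratnum (F i j) * D = P i j * ratden (F i j).
Proof.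
pose D := \prod_(p : 'I_n * 'I_n) ratden (F p.1 p.2).
exists (\matrix_(i, j) (ratnum (F i j) *
  \prod_(p : 'I_n * 'I_n | p != (i, j)) ratden (F p.1 p.2))), D; split.
  move=> z Oz; rewrite horner_prod; apply/prodf_neq0 => p _.
  exact: pole_free_den.
by move=> i j; rewrite mxE /D (bigD1 (i, j))//=; ring.
Qed.

Lemma contraction_family_represents S : contraction_family S ->
  exists P D, [/\ pole_free D, contractive P D & represents P D S].
Proof.
move=> [F F1 <-]; have [P [D [hD FP]]] := common_denominator F.
exists P, D; split=> //; first exact/(rational_contractive hD FP).
exact: rational_represents.
Qed.

Lemma represents_contraction_family P D : pole_free D -> contractive P D ->
  exists2 S, contraction_family S & represents P D S.
Proof.
move=> hD PD; pose F := \matrix_(i, j) RatFun (P i j) (pole_free_neq0 hD) hD : 'M[ratfun clO]_n.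
have FP i j : ratnum (F i j) * D = P i j * ratden (F i j) by rewrite mxE.
exists (ratmx_op F T); last exact: rational_represents.
by exists F => //=; apply/(rational_contractive hD FP).
Qed.

Lemma represents_family P D S : pole_free D -> contractive P D -> represents P D S ->
  contraction_family S.
Proof.
move=> hD PD SP; have [S' BS' S'P] := represents_contraction_family hD PD.
by rewrite (represents_unique hD SP S'P).
Qed.

Lemma represents_linear P D S : pole_free D -> represents P D S -> linear S.
Proof.
move=> /pole_free_bij/(pmx_op_scalar_bij n)[B BK KB] SP a x y.
rewrite -[x]KB -[y]KB -(pmx_op_lin T_lin) !SP; exact: pmx_op_lin.
Qed.

Lemma pmx_op_scalarC D P x :
  pmx_op T D%:M (pmx_op T P x) = pmx_op T P (pmx_op T D%:M x).
Proof. by rewrite -!(pmx_opM T_lin) scalar_mxC. Qed.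

Lemma represents_comp P D S P' D' S' : represents P D S -> represents P' D' S' ->
  represents (P *m P') (D * D') (S \o S').
Proof.
move=> SP SP' x /=; rewrite scalar_mxM (pmx_opM T_lin) pmx_op_scalarC SP'.
by rewrite -pmx_op_scalarC SP (pmx_opM T_lin).
Qed.

Lemma contractive_comp P D P' D' : contractive P D -> contractive P' D' ->
  contractive (P *m P') (D * D').
Proof.
move=> PD PD' z Oz v; rewrite evalmxM -mulmxA hornerM csqM -mulrA.
by apply: le_trans (PD z Oz _) _; rewrite ler_wpM2l ?csq_ge0// PD'.
Qed.

Lemma family_iter S k : contraction_family S -> contraction_family (iter k S).
Proof.
move=> BS; elim: k => [|k /contraction_family_represents[P' [D' [hD' PD' SP']]]].
  apply: (@represents_family 1%:M 1).
  - by move=> z _; rewrite hornerE oner_neq0.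
  - move=> z _ v; rewrite /evalmx map_mx1 mul1mx hornerE csq1 mul1r; exact: lexx.
  - by [].
have [P [D [hD PD SP]]] := contraction_family_represents BS.
rewrite (_ : iter k.+1 S = S \o iter k S)//.
apply: (@represents_family (P *m P') (D * D')).
- exact: pole_freeM.
- exact: contractive_comp.
- exact: represents_comp.
Qed.

Section Moebius.
Variables (P : MP n) (D : {poly R[i]}) (a : R[i]).
Hypotheses (hD : pole_free D) (PD : contractive P D) (a1 : csq a < 1).
(** For F = P / D, (a + F) (1 + a^* F)^-1 is N M^-1 with the N below. Writing M^-1 = adj M / det M
    gives polynomial entries over the single denominator det M. *)
Let M : MP n := D%:M + (Num.conj a)%:P *: P.
Let N : MP n := a%:P *: D%:M + P.
Let vP := cvdot_form R n.

Let evalM z (v : 'cV[R[i]]_n) : evalmx z M *m v = D.[z] *: v + Num.conj a *: (evalmx z P *m v).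
Proof.
rewrite /evalmx /M map_mxD map_mxZ map_scalar_mx mulmxDl mul_scalar_mx -scalemxAl.
by rewrite [X in _ + X *: _]hornerC.
Qed.

Let evalN z (v : 'cV[R[i]]_n) : evalmx z N *m v = a *: (D.[z] *: v) + evalmx z P *m v.
Proof.
rewrite /evalmx /N map_mxD map_mxZ map_scalar_mx mulmxDl -scalemxAl mul_scalar_mx.
rewrite /= (_ : horner_eval z a%:P = a)//; exact: hornerC.
Qed.

(** A kernel vector v of M(z) satisfies D v = -a^* P v, while |P v| <= |D v| and |a| < 1; hence P v
    = 0, then D v = 0 and v = 0. *)
Lemma moebius_pole_free : pole_free (\det M).
Proof.
move=> z Oz; have -> : (\det M).[z] = \det (evalmx z M)^T.
  by rewrite det_tr /evalmx det_map_mx.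
(* [det0P] produces a row vector killed from the left, which is why the determinant was
   transposed. *)
apply/negP => /det0P[v v0 vM].
have Mv : evalmx z M *m v^T = 0 by rewrite -[LHS]trmxK trmx_mul trmxK vM trmx0.
move: Mv; rewrite evalM => /eqP; rewrite addr_eq0 => /eqP Dv.
have := congr1 (fun u => vsq u) Dv.
rewrite -scaleN1r !(rf_scale2 vP) csqN csq1 mul1r csq_conj => Dv2.
have d0 : 0 < csq D.[z] by rewrite lt_neqAle csq_ge0 eq_sym csq_eq0 hD.
have := contractive_closure PD Oz v^T; rewrite Dv2 => h.
have Pv0 : vsq (evalmx z P *m v^T) = 0.
  apply/eqP; rewrite eq_le (rf_ge0 vP) andbT -(pmulr_rle0 _ (_ : 0 < 1 - csq a)).
    by rewrite mulrBl mul1r subr_le0.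
  by rewrite subr_gt0.
have : vsq v^T = 0.
  by move/eqP: Dv2; rewrite Pv0 mulr0 mulf_eq0 gt_eqF//= => /eqP.
by move/(@vsq_eq0 _ _ v^T)/eqP; rewrite trmx_eq0 (negPf v0).
Qed.

(** With u = adj M v, x = D u and y = P u, M u = det M v and |x + a^* y|^2 - |a x + y|^2 = (1 -
    |a|^2) (|x|^2 - |y|^2) >= 0. *)
Lemma moebius_contractive : contractive (N *m \adj M) (\det M).
Proof.
move=> z Oz v; rewrite evalmxM -mulmxA; set u := evalmx z (\adj M) *m v.
have -> : csq (\det M).[z] * vsq v = vsq (evalmx z M *m u).
  rewrite -(rf_scale2 vP) /u mulmxA -evalmxM mul_mx_adj /evalmx map_scalar_mx.
  by rewrite mul_scalar_mx.
have : vsq (evalmx z P *m u) <= vsq (D.[z] *: u) by rewrite (rf_scale2 vP); exact: PD.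
rewrite evalM evalN; move: (D.[z] *: u) (evalmx z P *m u) => x y yx.
rewrite !(rf_sqD vP) !(rf_scale2 vP) csq_conj (rf_conj vP a x).
have : 0 <= (1 - csq a) * (vsq x - vsq y) by rewrite mulr_ge0 ?subr_ge0// ltW.
lra.
Qed.

(** Every vector is D(T) y with y = det M(T) w. After both substitutions no inverse is left, and the
    claim is the polynomial identity N adj M M = N det M. *)
Lemma moebius_represents S G : represents P D S ->
  represents (N *m \adj M) (\det M) G ->
  forall x, G (x + Num.conj a *: S x) = a *: x + S x.
Proof.
move=> SP GN x.
have [B _ KB] := pmx_op_scalar_bij n (pole_free_bij hD).
have [B' _ KB'] := pmx_op_scalar_bij n (pole_free_bij moebius_pole_free).
rewrite -(KB x); move: (B x) => y; rewrite SP.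
have -> : pmx_op T D%:M y + Num.conj a *: pmx_op T P y = pmx_op T M y.
  by rewrite pmx_opD pmx_opZ.
have -> : a *: pmx_op T D%:M y + pmx_op T P y = pmx_op T N y.
  by rewrite pmx_opD pmx_opZ.
rewrite -(KB' y); move: (B' y) => w; rewrite -pmx_op_scalarC GN.
by rewrite -!(pmx_opM T_lin) -mulmxA mul_adj_mx.
Qed.

End Moebius.

Lemma contraction_family_moebius : moebius_class contraction_family.
Proof.
split.
- by move=> S /contraction_family_represents[P [D [hD _ SP]]]; exact: represents_linear hD SP.
- by move=> S k; exact: family_iter.
move=> S a /contraction_family_represents[P [D [hD PD SP]]] a1.
have [G BG GN] := represents_contraction_family (moebius_pole_free hD PD a1)
  (moebius_contractive PD a1).
by exists G => //; exact: moebius_represents SP GN.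
Qed.

End Matrices.

Definition rat_contractions : set (H -> H) :=
  [set rat_op f T | f in [set f : ratfun clO | (rat_norm Omega f <= 1%:E)%E]].

(** Since [l2sum 1 H] and H are different types, scalar functions are compared with 1 x 1 matrices.
    Only closure under powers and Moebius maps is transferred; norms and radii are then taken on
    H. *)
Definition lift1 (S : H -> H) (x : l2sum 1 H) : l2sum 1 H := [ffun i => S (x i)].

Definition const1 (x : H) : l2sum 1 H := [ffun=> x].

Lemma lift1_inj S S' : lift1 S = lift1 S' -> S = S'.
Proof.
move=> e; apply/funext => x.
have : lift1 S (const1 x) ord0 = lift1 S' (const1 x) ord0 by rewrite e.
by rewrite !ffunE.
Qed.

Lemma lift1_rat (f : ratfun clO) :
  lift1 (rat_op f T) = ratmx_op (const_mx f : 'M[ratfun clO]_1) T.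
Proof.
by apply/funext => x; apply/ffunP => i; rewrite !ffunE big_ord1 mxE (ord1 i).
Qed.

Lemma rat_norm_const (f : ratfun clO) :
  (ratmx_norm Omega (const_mx f : 'M[ratfun clO]_1) <= 1%:E)%E = (rat_norm Omega f <= 1%:E)%E.
Proof.
have E z : (mx_norm2 (map_mx (fun g => rat_eval g z) (const_mx f : 'M[ratfun clO]_1)) <= 1%:E)%E =
    (complex.Re `|rat_eval f z| <= 1).
  set A := map_mx _ _; set c := rat_eval f z.
  have AE v : vsq (A *m v) = csq c * vsq v.
    by rewrite !cvdotE !big_ord1 !mxE big_ord1 !mxE csqM.
  have c0 : 0 <= complex.Re `|c| by have := normr_ge0 c; rewrite lecE => /andP[].
  rewrite -(@expr_le1 _ 2 _ isT c0) -csq_Re_norm.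
  apply/idP/idP => [/(mx_norm2_le _ ler01)/(_ (const_mx 1))|c1].
    by rewrite AE cvdotE big_ord1 mxE csq1 expr1n !mulr1.
  apply/(mx_norm2_le _ ler01) => v; rewrite AE expr1n.
  by rewrite ler_wpM2r// (rf_ge0 (cvdot_form _ _)).
apply/idP/idP => h; apply: ge_ereal_sup => _ [z Oz <-].
  rewrite lee_fin -E; apply: le_trans h; apply: ereal_sup_ubound.
  by exists z.
by rewrite E -lee_fin; apply: le_trans h; apply: ereal_sup_ubound; exists z.
Qed.

Lemma rat_contractions_lift1 S : rat_contractions S <-> contraction_family (lift1 S).
Proof.
split=> [[f f1 <-]|[F F1 FS]].
  by exists (const_mx f); rewrite /= ?rat_norm_const// -lift1_rat.
have FE : F = const_mx (F 0 0).
  by apply/matrixP => i j; rewrite mxE (ord1 i) (ord1 j).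
exists (F 0 0) => /=; first by rewrite -rat_norm_const -FE.
by apply: lift1_inj; rewrite lift1_rat -FE.
Qed.

Lemma rat_contractions_moebius : moebius_class rat_contractions.
Proof.
have BP := contraction_family_moebius 1.
split.
- move=> S /rat_contractions_lift1/(mc_linear BP) Sl c x y.
  have := congr1 (fun v : l2sum 1 H => v ord0) (Sl c (const1 x) (const1 y)).
  by rewrite !ffunE.
- move=> S k /rat_contractions_lift1 /(mc_iter BP k) h; apply/rat_contractions_lift1.
  rewrite (_ : lift1 _ = iter k (lift1 S))//.
  elim: k {h} => [|k IH]; first by apply/funext => x; apply/ffunP => i; rewrite ffunE.
  by apply/funext => x; rewrite iterS -IH; apply/ffunP => i; rewrite !ffunE.
move=> S a /rat_contractions_lift1 /(mc_moebius BP) h /h[G BG GE].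
pose G0 h := G (const1 h) ord0.
have GG : lift1 G0 = G.
  apply/funext => x; apply/ffunP => i; rewrite ffunE /G0 (ord1 i).
  by congr (G _ _); apply/ffunP => j; rewrite ffunE (ord1 j).
exists G0; first by apply/rat_contractions_lift1; rewrite GG.
move=> x; rewrite /G0.
have := congr1 (fun v : l2sum 1 H => v ord0) (GE (const1 x)); rewrite !ffunE => <-.
by congr (G _ _); apply/ffunP => j; rewrite !ffunE.
Qed.

End RationalCalculus.

(** * Homogeneity and conclusion *)

Section Homogeneity.
Variables (R : realType) (H : hilbertType R).

Lemma op_norm_scale (S : H -> H) (l c : R) : 0 < l ->
  (op_norm S <= c%:E)%E -> (op_norm (fun x => l%:C *: S x) <= (l * c)%:E)%E.
Proof.
move=> l0 Sc; apply: ge_ereal_sup => _ [x x1 <-].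
rewrite !lee_fin !norm_nsq (rf_scale2 (rdot_form H)) csqR /= sqrtrM ?sqr_ge0//.
rewrite sqrtr_sqr ger0_norm ?(ltW l0)// ler_pM2l// -lee_fin.
by apply: le_trans Sc; apply: ereal_sup_ubound; exists x => //; rewrite norm_nsq.
Qed.

Lemma op_radius_scale (rho : R) (S : H -> H) (l c : R) : 0 < l ->
  (op_radius rho S <= c%:E)%E ->
  (op_radius rho (fun x => l%:C *: S x) <= (l * c)%:E)%E.
Proof.
move=> l0 Sc; apply/lee_addgt0Pr => e e0; rewrite -EFinD.
have Sce : (op_radius rho S < (c + e / l)%:E)%E.
  by apply: le_lt_trans Sc _; rewrite lte_fin ltrDl divr_gt0.
have [_ [m [m0 mC] <-] mc] := ereal_inf_lt Sce.
apply: (@le_trans _ _ (l * m)%:E); last first.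
  rewrite (_ : l * c + e = l * (c + e / l)); last by field; rewrite gt_eqF.
  by rewrite lee_fin ler_pM2l// -lee_fin ltW.
apply: ereal_inf_lbound; exists (l * m) => //; split; first exact: mulr_gt0.
rewrite (_ : (fun x => _) = (fun x => m^-1%:C *: S x))//.
apply/funext => x; rewrite scalerA -rmorphM invfM mulrAC mulVf ?mul1r//.
by rewrite gt_eqF.
Qed.

(* Rescaling f by any l > ||f|| brings it into the unit ball; the case
   ||f|| = 0 is covered by letting l tend to 0. *)
Lemma unit_ball_bound (X Y : Type) (op : X -> Y) (nm : X -> \bar R)
    (phi : Y -> \bar R) (c : R) : 0 < c -> (forall f, 0 <= nm f)%E ->
  (forall f (l : R), 0 < l -> (nm f <= l%:E)%E -> exists2 g, (nm g <= 1%:E)%E &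
     ((phi (op g) <= c%:E)%E -> (phi (op f) <= (l * c)%:E)%E)) ->
  (forall f, (phi (op f) <= c%:E * nm f)%E) <->
  (forall S, [set op f | f in [set f | (nm f <= 1%:E)%E]] S -> (phi S <= c%:E)%E).
Proof.
move=> c0 nm0 hom; split=> [h _ [f f1 <-]|h f].
  apply: le_trans (h f) _; rewrite -[leRHS]mule1.
  by rewrite lee_pmul2l.
case E : (nm f) (nm0 f) => [N| |] // N0; last by rewrite gt0_muley ?lte_fin// leey.
rewrite lee_fin in N0; apply/lee_addgt0Pr => e e0.
(* Scaling by l = N + e / c, positive even when N = 0, gives the bound l c = c N + e. *)
have ec : 0 < e / c by rewrite divr_gt0.
have [||g g1 gP] := hom f (N + e / c).
- by rewrite ltr_wpDl.
- by rewrite E lee_fin lerDl ltW.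
rewrite -EFinM -EFinD (_ : c * N + e = (N + e / c) * c).
  by apply: gP; apply: h; exists g.
by field; rewrite gt_eqF.
Qed.

End Homogeneity.

Section RationalScale.
Variables (R : realType) (H : hilbertType R) (T : H -> H) (Omega : set R[i]^o).
Local Notation clO := (closure Omega).

Definition rat_scale (a : R[i]) (f : ratfun clO) : ratfun clO :=
  RatFun (a *: ratnum f) (ratden_neq0 f) (@ratden_off _ _ f).

Lemma rat_scale_eval a f z : rat_eval (rat_scale a f) z = a * rat_eval f z.
Proof. by rewrite /rat_eval /= hornerZ mulrA. Qed.

Lemma rat_scale_op a f x : rat_op (rat_scale a f) T x = a *: rat_op f T x.
Proof. exact: poly_opZ. Qed.

Lemma rat_norm_scale (l : R) f : 0 < l -> (rat_norm Omega f <= l%:E)%E ->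
  (rat_norm Omega (rat_scale (l^-1)%:C f) <= 1%:E)%E.
Proof.
move=> l0 fl; apply: ge_ereal_sup => _ [z Oz <-].
have h : ((complex.Re `|rat_eval f z|)%:E <= l%:E)%E.
  by apply: le_trans fl; apply: ereal_sup_ubound; exists z.
have li : 0 <= (l^-1)%:C :> R[i] by rewrite ler0c invr_ge0 ltW.
by rewrite rat_scale_eval normrM (ger0_norm li) cReZ lee_fin mulrC ler_pdivrMr// mul1r -lee_fin.
Qed.

Lemma ratmx_norm_scale n (l : R) (F : 'M[ratfun clO]_n) : 0 < l ->
  (ratmx_norm Omega F <= l%:E)%E ->
  (ratmx_norm Omega (map_mx (rat_scale (l^-1)%:C) F) <= 1%:E)%E.
Proof.
move=> l0 Fl; apply: ge_ereal_sup => _ [z Oz <-].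
have h : (mx_norm2 (map_mx (fun f => rat_eval f z) F) <= l%:E)%E.
  by apply: le_trans Fl; apply: ereal_sup_ubound; exists z.
apply/(mx_norm2_le _ ler01) => v.
rewrite (_ : map_mx _ _ = (l^-1)%:C *: map_mx (fun f => rat_eval f z) F); last first.
  by apply/matrixP => i j; rewrite !mxE rat_scale_eval.
rewrite -scalemxAl (rf_scale2 (cvdot_form _ _)) csqR expr1n mul1r exprVn.
rewrite ler_pdivrMl ?exprn_gt0//; move: v; exact/(mx_norm2_le _ (ltW l0)).
Qed.

Lemma rat_scaleK_op (l : R) (f : ratfun clO) : 0 < l ->
  rat_op f T = fun x => l%:C *: rat_op (rat_scale (l^-1)%:C f) T x.
Proof.
move=> l0; apply/funext => x; rewrite rat_scale_op scalerA -rmorphM divff ?gt_eqF//.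
by rewrite scale1r.
Qed.

Lemma ratmx_scaleK_op n (l : R) (F : 'M[ratfun clO]_n) : 0 < l ->
  ratmx_op F T = fun x => l%:C *: ratmx_op (map_mx (rat_scale (l^-1)%:C) F) T x.
Proof.
move=> l0; apply/funext => x; apply/ffunP => i; rewrite !ffunE scaler_sumr.
by apply: eq_bigr => j _; rewrite mxE (rat_scaleK_op _ l0).
Qed.

Lemma ratmx_norm_ge0 n (F : 'M[ratfun clO]_n) : Omega !=set0 ->
  (0 <= ratmx_norm Omega F)%E.
Proof.
move=> [z Oz]; set A := map_mx (fun f => rat_eval f z) F.
apply: (@le_trans _ _ (mx_norm2 A)); last by apply: ereal_sup_ubound; exists z.
apply: ereal_sup_ubound; exists 0; last by rewrite mulmx0 l2norm_vsq (rf0l (cvdot_form _ _)) sqrtr0.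
by rewrite /= l2norm_vsq (rf0l (cvdot_form _ _)) sqrtr0.
Qed.

End RationalScale.

Lemma op_norm_ge0 (R : realType) (H : hilbertType R) (S : H -> H) :
  (0 <= op_norm S)%E.
Proof.
apply: (@le_trans _ _ (complex.Re `|S 0|)%:E).
  by rewrite lee_fin norm_nsq sqrtr_ge0.
by apply: ereal_sup_ubound; exists 0 => //=; rewrite normr0.
Qed.

Lemma op_radius_ge0 (R : realType) (H : hilbertType R) (rho : R) (S : H -> H) :
  (0 <= op_radius rho S)%E.
Proof. by apply: le_ereal_inf_tmp => _ [l [l0 _] <-]; rewrite lee_fin ltW. Qed.

Section Families.
Variables (R : realType) (H : hilbertType R) (T : H -> H) (Omega : set R[i]^o).
Variables (K rho : R).
Hypotheses (T_lin : linear T) (T_spectrum : spectrum T `<=` closure Omega).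
Hypotheses (K_ge1 : 1 <= K) (rho_ge1 : 1 <= rho).
Hypothesis Omega0 : Omega !=set0.
Local Notation clO := (closure Omega).

Let K0 : 0 < K. Proof. exact: lt_le_trans ltr01 K_ge1. Qed.

Let Kt0 : 0 < Ktilde K rho.
Proof. exact: lt_le_trans ltr01 (Ktilde_ge1 rho_ge1 K_ge1). Qed.

Lemma scalar_equivalence :
  spectral_set K Omega T <-> radius_set (Ktilde K rho) rho Omega T.
Proof.
have BP := rat_contractions_moebius T_lin T_spectrum Omega0.
have unit_ball (phi : (H -> H) -> \bar R) (c : R) : 0 < c ->
    (forall S (l d : R), 0 < l -> (phi S <= d%:E)%E ->
       (phi (fun x => l%:C *: S x) <= (l * d)%:E)%E) ->
    (forall f : ratfun clO, (phi (rat_op f T) <= c%:E * rat_norm Omega f)%E) <->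
    (forall S, rat_contractions T Omega S -> (phi S <= c%:E)%E).
  move=> c0 phiZ; apply: (@unit_ball_bound _ _ _ (fun f => rat_op f T)) => //.
    by move=> f; exact: rat_norm_ge0.
  move=> f l l0 fl; exists (rat_scale (l^-1)%:C f); first exact: rat_norm_scale.
  by rewrite [X in _ -> (phi X <= _)%E](rat_scaleK_op T f l0); exact: phiZ.
apply: (iff_trans (unit_ball (@op_norm R H) K K0 _)).
  by move=> S l d; exact: op_norm_scale.
apply: iff_sym.
apply: (iff_trans (unit_ball (@op_radius R rho H) _ Kt0 _)).
  by move=> S l d; exact: op_radius_scale.
split; [exact: radius_norm | exact: norm_radius].
Qed.

Lemma matrix_equivalence n :
  (forall F : 'M[ratfun clO]_n, (op_norm (ratmx_op F T) <= K%:E * ratmx_norm Omega F)%E) <->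
  (forall F : 'M[ratfun clO]_n,
     (op_radius rho (ratmx_op F T) <= (Ktilde K rho)%:E * ratmx_norm Omega F)%E).
Proof.
have BP := contraction_family_moebius T_lin T_spectrum Omega0 n.
have unit_ball (phi : (l2sum n H -> l2sum n H) -> \bar R) (c : R) : 0 < c ->
    (forall S (l d : R), 0 < l -> (phi S <= d%:E)%E ->
       (phi (fun x => l%:C *: S x) <= (l * d)%:E)%E) ->
    (forall F : 'M[ratfun clO]_n, (phi (ratmx_op F T) <= c%:E * ratmx_norm Omega F)%E) <->
    (forall S : l2sum n H -> l2sum n H, contraction_family T Omega S -> (phi S <= c%:E)%E).
  move=> c0 phiZ; apply: (@unit_ball_bound _ _ _ (fun F => ratmx_op F T)) => //.
    by move=> F; exact: ratmx_norm_ge0.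
  move=> F l l0 Fl; exists (map_mx (rat_scale (l^-1)%:C) F); first exact: ratmx_norm_scale.
  by rewrite [X in _ -> (phi X <= _)%E](ratmx_scaleK_op T F l0); exact: phiZ.
apply: (iff_trans (unit_ball (@op_norm R (l2sum n H)) K K0 _)).
  by move=> S l d; exact: op_norm_scale.
apply: iff_sym.
apply: (iff_trans (unit_ball (@op_radius R rho (l2sum n H)) _ Kt0 _)).
  by move=> S l d; exact: op_radius_scale.
split; [exact: radius_norm | exact: norm_radius].
Qed.

End Families.

Lemma empty_domain_bound (R : realType) (Y : Type) (phi : Y -> \bar R) (y : Y) (c : R) :
  0 < c -> (forall S, 0 <= phi S)%E -> ~ (phi y <= c%:E * -oo)%E.
Proof.
move=> c0 phi0 h; have := le_trans (phi0 y) h.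
by rewrite gt0_muleNy ?lte_fin// leeNy_eq.
Qed.

Theorem theorem5p1 (R : realType) (H : hilbertType R) (Omega : set R[i]^o)
    (T : H -> H) (K rho : R)
    (Omega_open : open Omega) (Omega_connected : connected Omega)
    (T_bounded : bounded_op T) (T_spectrum : spectrum T `<=` closure Omega)
    (K_ge1 : 1 <= K) (rho_ge1 : 1 <= rho) :
  (spectral_set K Omega T <-> radius_set (Ktilde K rho) rho Omega T) /\
  (complete_spectral_set K Omega T <->
     complete_radius_set (Ktilde K rho) rho Omega T).
Proof.
have [T_lin _] := T_bounded.
have [Om0|Om0] := pselect (Omega !=set0).
  split; first exact: scalar_equivalence.
  by split=> h n n0; apply/(matrix_equivalence T_lin T_spectrum K_ge1 rho_ge1 Om0); exact: h.
(* The supremum of the empty set is -oo: both sides of each equivalence fail. *)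
have K0 : 0 < K by exact: lt_le_trans ltr01 K_ge1.
have Kt0 : 0 < Ktilde K rho by exact: lt_le_trans ltr01 (Ktilde_ge1 rho_ge1 K_ge1).
have image0 (f : R[i]^o -> \bar R) : f @` Omega = set0.
  by rewrite -subset0 => x [z Oz _]; apply: Om0; exists z.
have off1 (z : R[i]) : closure Omega z -> (1 : {poly R[i]}).[z] != 0.
  by rewrite hornerE oner_neq0.
pose one : ratfun (closure Omega) := RatFun 1 (oner_neq0 _) off1.
have none : rat_norm Omega one = -oo%E by rewrite /rat_norm image0 ereal_sup0.
have nmone : ratmx_norm Omega (const_mx one : 'M[ratfun (closure Omega)]_1) = -oo%E.
  by rewrite /ratmx_norm image0 ereal_sup0.
split; split=> h; exfalso.
- have := h one; rewrite none; apply: empty_domain_bound => //; exact: op_norm_ge0.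
- have := h one; rewrite none; apply: empty_domain_bound => //; exact: op_radius_ge0.
- have := h 1%N isT (const_mx one); rewrite nmone.
  apply: empty_domain_bound => //; exact: op_norm_ge0.
- have := h 1%N isT (const_mx one); rewrite nmone.
  apply: empty_domain_bound => //; exact: op_radius_ge0.
Qed.
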